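(* Let $f:D\to D$ be a linear triangle map with angle transition matrix (ATM) $M$. Then: (a) The image $MD$ is a $30^\circ$-$60^\circ$-$90^\circ$ triangle in $A$ whose edges lie in $R$. (b) Consequently, there exist $|\det(M)|$ triangles of the form $gD$ ($g\in G$) that tile $MD$. (c) The preimages under $M$ of these $|\det(M)|$ triangles form a Markov partition of $D$, making $f$ semiconjugate to a one-sided Bernoulli shift on $|\det(M)|$ symbols. (d) Thus $f$ is mixing, and hence ergodic (with respect to normalized Lebesgue measure on $D$).
   Context: Let $A=\{(x,y,z)\in\mathbb{R}^3: x+y+z=1\}$ and $D=\{(\alpha_1,\alpha_2,\alpha_3)\in A:\alpha_1\ge\alpha_2\ge\alpha_3\ge 0\}$ (the set of ordered normalized interior angles of triangles, which is in bijection with the set of similarity classes of triangles, so that maps of similarity classes are identified with maps $D\to D$). Let $G$ be the group of $3\times 3$ matrices generated by the permutation matrices $P_{13}$ (swapping coordinates 1 and 3) and $P_{23}$ (swapping coordinates 2 and 3) and the matrix $\begin{bmatrix}1&0&1\\0&1&1\\0&0&-1\end{bmatrix}$. $G$ leaves $A$ invariant and acts on it by isometries as the wallpaper group $p6m$, generated by the reflections of $A$ across the lines cut out on $A$ by the planes $x=n$, $y=n$, $z=n$, $x-y=n$, $y-z=n$, $x-z=n$ ($n\in\mathbb{Z}$). Let $R\subset A$ be the union of these lines. Every $G$-orbit in $A$ contains exactly one point of $D$. For $v,v'\in A$ write $v\sim v'$ if $v'=gv$ for some $g\in G$. An angle transition matrix (ATM) is (the matrix of) an invertible linear map $M:\mathbb{R}^3\to\mathbb{R}^3$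 that leaves $A$ invariant ($MA\subset A$) and such that for all $v,v'\in A$, $v\sim v'$ implies $Mv\sim Mv'$. The linear triangle map $f:D\to D$ with ATM $M$ is defined by letting $f(v)$ be the unique point of $D$ in the $G$-orbit of $Mv$. Triangles tile $MD$ if their union is $MD$ and their interiors are pairwise disjoint. A Markov partition of $D$ for $f$ is a finite collection of closed sets with pairwise disjoint interiors covering $D$ such that $f$ is injective on each of them and maps each of them onto a union of members of the collection. The one-sided Bernoulli shift on $d$ symbols is the left shift $\sigma$ on $\{1,\dots,d\}^{\mathbb{N}}$ with the product measure giving each symbol weight $1/d$. ''$f$ is semiconjugate to'' this shift means that there is a continuous surjection $\pi:\{1,\dots,d\}^{\mathbb{N}}\to D$ with $\pi\circ\sigma=f\circ\pi$ that pushes the Bernoulli measure forward to normalized Lebesgue (area) measure on $D$.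
   Formalization: The semiconjugacy in (c) and all of (d) are stated under the added hypothesis |det(M)| > 1; for |det(M)| = 1 they fail (for M the identity, f is the identity on D, the one-symbol shift is a single point, and f is neither mixing nor ergodic). *)

(* Defs.v *)
From HB Require Import structures.
From mathcomp Require Import all_boot all_order all_algebra perm.
From mathcomp Require Import all_classical all_reals all_analysis.

Set Implicit Arguments.
Unset Strict Implicit.
Unset Printing Implicit Defensive.

Import Order.TTheory GRing.Theory Num.Theory.
Import numFieldNormedType.Exports.

Local Open Scope classical_set_scope.
Local Open Scope ring_scope.

Section Plane.
Variable R : realType.
Implicit Types (v w a b c : 'cV[R]_3) (M g : 'M[R]_3).

Definition planeA : set 'cV[R]_3 := [set v | v 0 0 + v 1 0 + v 2 0 = 1].

Definition domD : set 'cV[R]_3 :=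
  [set v | planeA v /\ (0 <= v 2 0 <= v 1 0) && (v 1 0 <= v 0 0)].

Definition flip3 : 'M[R]_3 := \matrix_(i, j)
  nth 0 (nth [::] [:: [:: 1; 0; 1]; [:: 0; 1; 1]; [:: 0; 0; -1]] i) j.

(* Indices run over {0, 1, 2}: the transpositions (0 2) and (1 2) exchange
   the coordinates 1, 3 and 2, 3 respectively.                              *)
Inductive inG : 'M[R]_3 -> Prop :=
| inG_P13 : inG (tperm_mx 0 2)
| inG_P23 : inG (tperm_mx 1 2)
| inG_flip : inG flip3
| inG_one : inG 1%:M
| inG_mul g h of inG g & inG h : inG (g *m h)
| inG_inv g of inG g : inG (invmx g).

Definition equivG v w : Prop := exists2 g, inG g & w = g *m v.

Definition mirrors : set 'cV[R]_3 := [set v | planeA v /\ exists n : int,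
  v 0 0 = n%:~R \/ v 1 0 = n%:~R \/ v 2 0 = n%:~R \/
  v 0 0 - v 1 0 = n%:~R \/ v 1 0 - v 2 0 = n%:~R \/ v 0 0 - v 2 0 = n%:~R].

Definition ATM M : Prop :=
  [/\ M \in unitmx,
      forall v, planeA v -> planeA (M *m v) &
      forall v w, planeA v -> planeA w -> equivG v w ->
        equivG (M *m v) (M *m w)].

(* Only the values of [f] on [domD] matter. Every orbit in [planeA] meets
   [domD] in exactly one point, so these values are determined by [M].      *)
Definition linear_triangle_map M (f : 'cV[R]_3 -> 'cV[R]_3) : Prop :=
  forall v, domD v -> domD (f v) /\ equivG (M *m v) (f v).

(* The norm of 'cV[R]_3 in the library is the sup norm, hence the explicit
   Euclidean one.                                                           *)
Definition dot v w : R := \sum_i v i 0 * w i 0.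
Definition enorm v : R := Num.sqrt (dot v v).

(* angle at the vertex a of the triangle a b c *)
Definition angle a b c : R :=
  acos (dot (b - a) (c - a) / (enorm (b - a) * enorm (c - a))).

Definition segm a b : set 'cV[R]_3 :=
  [set v | exists2 t : R, 0 <= t <= 1 & v = (1 - t) *: a + t *: b].

Definition triangle a b c : set 'cV[R]_3 :=
  [set v | exists r s t : R, [/\ 0 <= r, 0 <= s, 0 <= t, r + s + t = 1 &
                                 v = r *: a + s *: b + t *: c]].

Definition triangle_30_60_90 a b c : Prop :=
  [/\ angle a b c = pi / 6, angle b c a = pi / 3 & angle c a b = pi / 2].

(* interior of S relative to X, for S a subset of X *)
Definition relint (X S : set 'cV[R]_3) : set 'cV[R]_3 :=
  [set v | X v /\ within X (nbhs v) S].

Definition disjoint_interiors (X : set 'cV[R]_3) (I : Type)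
    (P : I -> set 'cV[R]_3) : Prop :=
  forall i j, i <> j -> relint X (P i) `&` relint X (P j) = set0.

Definition tiles (I : Type) (T : I -> set 'cV[R]_3) (S : set 'cV[R]_3) : Prop :=
  \bigcup_i T i = S /\ disjoint_interiors planeA T.

(* Interiors are taken in the space [domD] on which f acts. *)
Definition markov_partition (I : finType) (f : 'cV[R]_3 -> 'cV[R]_3)
    (P : I -> set 'cV[R]_3) : Prop :=
  [/\ forall i, closed (P i),
      \bigcup_i P i = domD,
      disjoint_interiors domD P,
      forall i, set_inj (P i) f &
      forall i, exists J : set I, f @` P i = \bigcup_(j in J) P j].

Definition chart (p : R * R) : 'cV[R]_3 :=
  \col_i nth 0 [:: p.1; p.2; 1 - p.1 - p.2] i.

(* Area of a subset of [planeA]. The chart of [planeA] by its first two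
   coordinates multiplies areas by sqrt 3.                                  *)
Definition area (S : set 'cV[R]_3) : \bar R :=
  ((Num.sqrt 3)%:E *
   (@lebesgue_measure R \x @lebesgue_measure R) (chart @^-1` S))%E.

Definition muD (S : set 'cV[R]_3) : R :=
  fine (area (S `&` domD)) / fine (area domD).

Definition borel : set (set 'cV[R]_3) := <<s open >>.

Definition measure_preserving (f : 'cV[R]_3 -> 'cV[R]_3) : Prop :=
  forall E, borel E ->
    borel (domD `&` f @^-1` E) /\ muD (f @^-1` E) = muD E.

Definition mixing (f : 'cV[R]_3 -> 'cV[R]_3) : Prop :=
  measure_preserving f /\
  forall E F, borel E -> borel F ->
    muD (F `&` iter n f @^-1` E) @[n --> \oo] --> muD F * muD E.

Definition ergodic (f : 'cV[R]_3 -> 'cV[R]_3) : Prop :=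
  measure_preserving f /\
  forall E, borel E -> E `<=` domD -> domD `&` f @^-1` E = E ->
    muD E = 0 \/ muD E = 1.

End Plane.

(* One-sided sequences on the d.+1 symbols 0, ..., d, with the product of the
   discrete topologies and its Borel sigma-algebra. The successor keeps the
   alphabet nonempty, as pointed types require.                             *)
Definition seqspace (d : nat) : Type :=
  {ptws nat -> discrete_topology 'I_d.+1}.

HB.instance Definition _ d := Topological.on (seqspace d).
HB.instance Definition _ d := isPointed.Build (seqspace d) (fun=> ord0).

Definition shift d (w : seqspace d) : seqspace d := fun n => w n.+1.

Definition seqborel (d : nat) := g_sigma_algebraType (@open (seqspace d)).

(* The product measure of uniform weights, characterized by its values on
   cylinders.                                                               *)
Definition is_bernoulli (R : realType) d (nu : probability (seqborel d) R) :=
  forall (n : nat) (u : nat -> 'I_d.+1),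
    nu [set w : seqspace d | forall i, (i < n)%N -> w i = u i] =
    (d.+1%:R ^- n)%:E.

Definition semiconjugate_bernoulli (R : realType) (d : nat)
    (f : 'cV[R]_3 -> 'cV[R]_3) : Prop :=
  exists (nu : probability (seqborel d) R) (h : seqspace d -> 'cV[R]_3),
    [/\ is_bernoulli nu,
        continuous h,
        range h = @domD R,
        forall w, h (shift w) = f (h w) &
        forall E, borel E -> nu (h @^-1` E) = (muD E)%:E].

(* Main.v *)
(* G is the set of maps v |-> e P v + t of the plane A, with e a sign, P a
   permutation matrix and t an integral vector, and D is a strict fundamental
   domain.  For g in G, each v in A satisfies M g v = g' M v for some g' in the
   countable group G; a fixed g' then occurs on three points spanning R^3, so
   that M g = g' M.  Conjugation by M thus maps G into itself.  The reflections
   in the sides of D are conjugated to elements of G fixing the sides of M D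
   and reversing the orientation, hence these sides lie on mirrors; and the
   quadratic form |M u|^2 is invariant under the permutations of the
   coordinates, so that M is a similarity with ratio |det M|^(1/2).
   A mirror does not cross the interior of a chamber g D, so that the chambers
   meeting the interior of M D tile M D, and comparing areas there are |det M|
   of them.  On D, f has |det M| inverse branches M^-1 g, which are contracting
   similarities of D onto the pieces of the partition: the points of D are
   coded by itineraries.  The Bernoulli measure is obtained as the image of the
   uniform measure of D by the coding map, and mixing is transferred from the
   shift, where it is checked on cylinders.                                  *)
Require Import Defs.
From HB Require Import structures.
From mathcomp Require Import all_boot all_order all_algebra.
From mathcomp Require Import all_classical all_reals all_analysis measurable_realfun.
From mathcomp Require Import perm zify ring lra.

Set Implicit Arguments.
Unset Strict Implicit.
Unset Printing Implicit Defensive.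

Import Order.TTheory GRing.Theory Num.Theory.
Import numFieldNormedType.Exports.

Local Open Scope classical_set_scope.
Local Open Scope ring_scope.

(** * The group G as affine maps *)

(** An ATM only relates orbits, so the element [g'] with M g v = g' M v may a priori vary with v;
    the countability of G makes it constant without any continuity argument. The coding runs both
    ways: the map from sequences to D is continuous and intertwines the shift with [f] everywhere,
    while the itinerary map is a section of it that is merely Borel, since a choice is made where
    pieces overlap; the section serves to carry measures from D to the sequence space. The values of
    [f] off D are arbitrary, so measurability is established for a Borel substitute that agrees with
    [f] on D. The condition 1 < |det M| excludes a degenerate case: if |det M| = 1, then [f] is the
    identity on D, which is not mixing, and the sequences on one symbol form a single point, which
    cannot be mapped onto D. *)

Lemma forall_ord3 (P : 'I_3 -> Prop) : P 0 -> P 1 -> P 2 -> forall i, P i.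
Proof.
move=> P0 P1 P2 [[|[|[|//]]] hi].
- by rewrite (_ : Ordinal hi = 0) //; apply: val_inj.
- by rewrite (_ : Ordinal hi = 1) //; apply: val_inj.
- by rewrite (_ : Ordinal hi = 2) //; apply: val_inj.
Qed.

Lemma big_ord3 (V : nmodType) (F : 'I_3 -> V) :
  \sum_i F i = F 0 + F 1 + F 2.
Proof.
rewrite !big_ord_recl big_ord0 addr0 addrA.
by congr (F _ + F _ + F _); apply: val_inj.
Qed.

(** The even permutations are grouped apart from the three transpositions, which are the ones that
    give reflections. *)
Lemma perm3_cases (s : 'S_3) :
  [\/ [\/ [/\ s 0 = 0, s 1 = 1 & s 2 = 2],
          [/\ s 0 = 1, s 1 = 2 & s 2 = 0] |
          [/\ s 0 = 2, s 1 = 0 & s 2 = 1]],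
      [/\ s 0 = 0, s 1 = 2 & s 2 = 1],
      [/\ s 0 = 2, s 1 = 1 & s 2 = 0] |
      [/\ s 0 = 1, s 1 = 0 & s 2 = 2]].
Proof.
have inj := @perm_inj _ s.
have h01 : s 0 <> s 1 by move=> /inj.
have h02 : s 0 <> s 2 by move=> /inj.
have h12 : s 1 <> s 2 by move=> /inj.
move: h01 h02 h12.
move: (s 0) (s 1) (s 2).
elim/forall_ord3; elim/forall_ord3; elim/forall_ord3 => h01 h02 h12;
 by [case: (h01) | case: (h02) | case: (h12)
    | constructor 1; constructor | constructor 1; constructor 2
    | constructor 1; constructor 3
    | constructor 2 | constructor 3 | constructor 4].
Qed.

Lemma det2 (K : comNzRingType) (N : 'M[K]_2) :
  \det N = N 0 0 * N 1 1 - N 0 1 * N 1 0.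
Proof.
rewrite (expand_det_row _ 0) !big_ord_recl big_ord0 /cofactor !det_mx11 !mxE /=.
have l (i : 'I_2) (j : 'I_1) (k : 'I_2) : val (lift i j) = k -> lift i j = k.
  by move=> h; apply: val_inj.
by rewrite (l 0 0 1) // (l 1 0 0) //= expr0 expr1; ring.
Qed.

Lemma det3 (K : comNzRingType) (N : 'M[K]_3) :
  \det N = N 0 0 * (N 1 1 * N 2 2 - N 1 2 * N 2 1)
         - N 0 1 * (N 1 0 * N 2 2 - N 1 2 * N 2 0)
         + N 0 2 * (N 1 0 * N 2 1 - N 1 1 * N 2 0).
Proof.
rewrite (expand_det_row _ 0) big_ord3 /cofactor !det2 !mxE /=.
have l (i : 'I_3) (j : 'I_2) (k : 'I_3) : val (lift i j) = k -> lift i j = k.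
  by move=> h; apply: val_inj.
rewrite (l 0 0 1) // (l 0 1 2) // (l 1 0 0) // (l 1 1 2) // (l 2 0 0) //.
by rewrite (l 2 1 1) //= expr0 expr1 expr2; ring.
Qed.

Section Geometry.
Variable R : realType.
Implicit Types (u v w : 'cV[R]_3) (M N g h : 'M[R]_3).

Lemma cV3P v w : v 0 0 = w 0 0 -> v 1 0 = w 1 0 -> v 2 0 = w 2 0 -> v = w.
Proof.
by move=> h0 h1 h2; apply/colP; apply: forall_ord3.
Qed.

Lemma mulmx_cV3 N v i :
  (N *m v) i 0 = N i 0 * v 0 0 + N i 1 * v 1 0 + N i 2 * v 2 0.
Proof. by rewrite mxE big_ord3. Qed.

(** Column sums 1 mean that the sum of the coordinates is preserved, hence both [planeA] and the
    vectors of sum 0. *)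
Definition affmx N := forall j, N 0 j + N 1 j + N 2 j = 1.

Lemma affmxM N N' : affmx N -> affmx N' -> affmx (N *m N').
Proof.
move=> hN hN' j; rewrite -(hN' j) !mxE !big_ord3.
have := hN 0; have := hN 1; have := hN 2 => h2 h1 h0.
rewrite -[N' 0 j in RHS]mul1r -[N' 1 j in RHS]mul1r -[N' 2 j in RHS]mul1r.
rewrite -{1}h0 -{1}h1 -{1}h2; ring.
Qed.

Lemma planeA_affmx N v : affmx N -> planeA v -> planeA (N *m v).
Proof.
move=> hN; rewrite /planeA /= !mulmx_cV3 => hv; rewrite -{}hv.
have := hN 0; have := hN 1; have := hN 2 => h2 h1 h0.
rewrite -[v 0 0 in RHS]mul1r -[v 1 0 in RHS]mul1r -[v 2 0 in RHS]mul1r.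
rewrite -{1}h0 -{1}h1 -{1}h2; ring.
Qed.

Definition vec3 (x y z : R) : 'cV[R]_3 := \col_i nth 0 [:: x; y; z] i.

Lemma vec3E0 x y z : vec3 x y z 0 0 = x. Proof. by rewrite mxE. Qed.
Lemma vec3E1 x y z : vec3 x y z 1 0 = y. Proof. by rewrite mxE. Qed.
Lemma vec3E2 x y z : vec3 x y z 2 0 = z. Proof. by rewrite mxE. Qed.
Definition vec3E := (vec3E0, vec3E1, vec3E2).

Lemma affmx_planeA N : (forall v, planeA v -> planeA (N *m v)) -> affmx N.
Proof.
move=> hN; elim/forall_ord3.
- have := hN (vec3 1 0 0); rewrite /planeA /= !mulmx_cV3 !vec3E => h.
  by rewrite -[RHS]h; [ring|rewrite !addr0].
- have := hN (vec3 0 1 0); rewrite /planeA /= !mulmx_cV3 !vec3E => h.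
  by rewrite -[RHS]h; [ring|rewrite addr0 add0r].
- have := hN (vec3 0 0 1); rewrite /planeA /= !mulmx_cV3 !vec3E => h.
  by rewrite -[RHS]h; [ring|rewrite !add0r].
Qed.

Lemma affmx_inv N : N \in unitmx -> affmx N -> affmx (invmx N).
Proof.
move=> uN hN j.
have /matrixP e : const_mx 1 *m N = const_mx 1 :> 'rV_3.
  by apply/rowP=> k; rewrite !mxE big_ord3 !mxE !mul1r hN.
have /matrixP/(_ 0 j) : const_mx 1 *m invmx N = const_mx 1 :> 'rV[R]_3.
  have -> : const_mx 1 = const_mx 1 *m N :> 'rV_3 by apply/matrixP => a b; rewrite e.
  by rewrite mulmxK //; apply/matrixP => a b; rewrite e.
by rewrite !mxE big_ord3 !mxE !mul1r.
Qed.

(* The elements of G act on [planeA] as v |-> e P v + t, where P permutes the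
   coordinates; t is integral and its coordinate sum makes [planeA] stable.  *)
Definition Gform g (e : R) (s : 'S_3) (t : 'I_3 -> int) :=
  [/\ e = 1 \/ e = -1, (t 0 + t 1 + t 2)%:~R = 1 - e &
      forall i j, g i j = e * (s i == j)%:R + (t i)%:~R].

Lemma Gform_aff g e s t : Gform g e s t -> affmx g.
Proof.
case=> _ ht hg j; rewrite !hg.
have hs : (s 0 == j)%:R + (s 1 == j)%:R + (s 2 == j)%:R = 1 :> R.
  have [i ->] : exists i, j = s i by exists (s^-1 j)%g; rewrite permKV.
  rewrite !(inj_eq perm_inj).
  by move: i; elim/forall_ord3; rewrite /= ?addr0 ?add0r.
have : e * ((s 0 == j)%:R + (s 1 == j)%:R + (s 2 == j)%:R) = e by rewrite hs mulr1.
move: ht; rewrite !rmorphD /=; lra.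
Qed.

(** The translation part of the composite is e P t' + t. The sign [e] is a real number while
    translations are integral, hence the integer sign obtained by testing [e]. *)
Lemma Gform_mul g h e s t e' s' t' : Gform g e s t -> Gform h e' s' t' ->
  Gform (g *m h) (e * e') (s * s') (fun i => (if e == 1 then 1 else -1) * t' (s i)
      + t i).
Proof.
move=> Gg Gh; have hh := Gform_aff Gh; move: Gg Gh => [he ht hg] [he' ht' hh'].
have eE : (if e == 1 then 1 else -1)%:~R = e.
  case: he => ->; rewrite ?eqxx //.
  by rewrite lt_eqF ?rmorphN //; lra.
have hsum (F : 'I_3 -> R) : F (s 0) + F (s 1) + F (s 2) = F 0 + F 1 + F 2.
  by rewrite -(big_ord3 (fun i => F (s i))) -big_ord3 [RHS](reindex_inj (@perm_inj
      _ s)).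
split.
- by case: he => ->; case: he' => ->; [left|right|right|left]; lra.
- rewrite !rmorphD !rmorphM /= eE.
  have := hsum (fun i => (t' i)%:~R); move: ht ht'; rewrite !rmorphD /=.
  move=> h1 h2 h3.
  by case: he h1 => ->; case: he' h2 => ->; lra.
- move=> i j; rewrite mxE.
  under eq_bigr do rewrite hg mulrDl.
  rewrite big_split /= -mulr_sumr [X in _ + _ * X = _]big_ord3 hh mulr1 permM
      rmorphD rmorphM /= eE.
  rewrite addrA; congr (_ + _); rewrite (bigD1 (s i)) //= big1 ?addr0; last first.
    by move=> k /negbTE; rewrite eq_sym => ->; rewrite mulr0 mul0r.
  by rewrite eqxx mulr1 hh' mulrDr mulrA.
Qed.

Lemma Gform_ext g e s (t t' : 'I_3 -> int) : t =1 t' ->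
  Gform g e s t -> Gform g e s t'.
Proof.
move=> et [he ht hg]; split=> // [|i j]; first by rewrite -!et.
by rewrite hg et.
Qed.

Lemma Gform1 : Gform 1%:M 1 1%g (fun=> 0).
Proof.
by split=> [||i j]; [left|rewrite !addr0 subrr|rewrite perm1 addr0 mul1r mxE].
Qed.

Lemma Gform_inj g h e s t : Gform g e s t -> Gform h e s t -> g = h.
Proof. by move=> [_ _ hg] [_ _ hh]; apply/matrixP=> i j; rewrite hg hh. Qed.

Lemma Gform_inv g e s t : Gform g e s t ->
  [/\ g \in unitmx, exists t', Gform (invmx g) e s^-1 t' & e * e = 1].
Proof.
move=> Gg; have [he ht hg] := Gg.
have ee : e * e = 1 by case: he => ->; lra.
have eE : (if e == 1 then 1 else -1)%:~R = e.
  case: he => ->; rewrite ?eqxx //.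
  by rewrite lt_eqF ?rmorphN //; lra.
have hsum (F : 'I_3 -> R) (p : 'S_3) : F (p 0) + F (p 1) + F (p 2) = F 0 + F 1 + F 2.
  by rewrite -(big_ord3 (fun i => F (p i))) -big_ord3 [RHS](reindex_inj (@perm_inj
      _ p)).
pose t' := fun i => - ((if e == 1 then 1 else -1) * t (s^-1%g i)).
pose g' : 'M[R]_3 := \matrix_(i, j) (e * (s^-1%g i == j)%:R + (t' i)%:~R).
have Gg' : Gform g' e s^-1 t'.
  split=> // [|i j]; last by rewrite mxE.
  rewrite /t' !rmorphD !rmorphN !rmorphM /= eE.
  have := hsum (fun i => (t i)%:~R) s^-1%g; move: ht; rewrite !rmorphD /= => h1 h2.
  by case: he h1 => ->; lra.
have gg' : g' *m g = 1%:M.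
  have := Gform_mul Gg' Gg; rewrite ee mulVg => h; apply: Gform_inj h _.
  apply: Gform_ext Gform1 => // i; by rewrite /t' subrr.
have [_ ug] := mulmx1_unit gg'.
by split=> //; exists t'; rewrite -[invmx g]mul1mx -gg' mulmxK.
Qed.

Lemma tperm_Gform (i j : 'I_3) : Gform (tperm_mx i j) 1 (tperm i j) (fun=> 0).
Proof.
by split=> [||k l]; [left|rewrite !addr0 subrr|rewrite addr0 mul1r !mxE].
Qed.

(** On the plane x + z = 1 - y and y + z = 1 - x, so the matrix acts by (x, y, z) -> (1 - y, 1 - x,
    -z), the reflection in the line z = 0. *)
Lemma flip3_Gform : Gform (flip3 R) (-1) (tperm 0 1) (fun i => (i != 2)%:Z).
Proof.
split=> [||i j]; [by right|by rewrite /=; lra|rewrite mxE].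
by move: i j; elim/forall_ord3; elim/forall_ord3;
  rewrite ?tpermL ?tpermR ?tpermD //=; lra.
Qed.

Lemma inG_Gform g : inG g -> exists e s t, Gform g e s t.
Proof.
elim=> [|||| {}g h _ [e [s [t Gg]]] _ [e' [s' [t' Gh]]]| {}g _ [e [s [t Gg]]]].
- by do 3!eexists; exact: tperm_Gform.
- by do 3!eexists; exact: tperm_Gform.
- by do 3!eexists; exact: flip3_Gform.
- by do 3!eexists; exact: Gform1.
- by do 3!eexists; exact: Gform_mul Gg Gh.
- by have [_ [t' h] _] := Gform_inv Gg; exists e, s^-1%g, t'.
Qed.

Lemma inG_aff g : inG g -> affmx g.
Proof. by move=> /inG_Gform[e [s [t /Gform_aff]]]. Qed.

Lemma inG_unit g : inG g -> g \in unitmx.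
Proof. by move=> /inG_Gform[e [s [t /Gform_inv[]]]]. Qed.

Lemma Gform_mulv g e s t v i : Gform g e s t -> planeA v ->
  (g *m v) i 0 = e * v (s i) 0 + (t i)%:~R.
Proof.
move=> [_ _ hg] hv; rewrite mulmx_cV3 !hg.
have -> : v (s i) 0 = (s i == 0)%:R * v 0 0 + (s i == 1)%:R * v 1 0 + (s i == 2)%:R
    * v 2 0.
  by move: (s i); elim/forall_ord3; rewrite /= ?mul1r ?mul0r ?addr0 ?add0r.
rewrite [in RHS](_ : (t i)%:~R = (t i)%:~R * (v 0 0 + v 1 0 + v 2 0) :> R).
  by ring.
by rewrite hv mulr1.
Qed.

(** The determinant is the signature of [s]: on the two-dimensional space of vectors of sum 0 the
    map is e P, and the sign contributes e^2 = 1. For a transposition the indices are recorded in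
    order to locate the axis. *)
Lemma Gform_det g e s t : Gform g e s t ->
  \det g = 1 \/
  \det g = -1 /\ exists i j k, [/\ s i = j, s j = i & s k = k] /\
     [/\ i != j, i != k & j != k].
Proof.
move=> [he]; rewrite !rmorphD /= => ht hg; rewrite det3 !hg.
case: (perm3_cases s) => [[][-> -> ->]|h|h|h].
1-3: by left; case: he ht => -> ht /=; lra.
- right; split; last by exists 1, 2, 0; case: h => -> -> ->.
  by case: h => -> -> ->; case: he ht => -> ht /=; lra.
- right; split; last by exists 0, 2, 1; case: h => -> -> ->.
  by case: h => -> -> ->; case: he ht => -> ht /=; lra.
- right; split; last by exists 0, 1, 2; case: h => -> -> ->.
  by case: h => -> -> ->; case: he ht => -> ht /=; lra.
Qed.

Lemma inG_det g : inG g -> `|\det g| = 1.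
Proof.
move=> /inG_Gform[e [s [t /Gform_det[->|[-> _]]]]]; first exact: normr1.
by rewrite normrN1.
Qed.

Lemma inG_isom g u : inG g -> u 0 0 + u 1 0 + u 2 0 = 0 ->
  dot (g *m u) (g *m u) = dot u u.
Proof.
move=> /inG_Gform[e [s [t [he ht hg]]]] hu.
have ee : e * e = 1 by case: he => ->; lra.
have E i : (g *m u) i 0 = e * u (s i) 0.
  rewrite mulmx_cV3 !hg.
  have -> : u (s i) 0 = (s i == 0)%:R * u 0 0 + (s i == 1)%:R * u 1 0 + (s i ==
      2)%:R * u 2 0.
    by move: (s i); elim/forall_ord3; rewrite /= ?mul1r ?mul0r ?addr0 ?add0r.
  transitivity (e * ((s i == 0)%:R * u 0 0 + (s i == 1)%:R * u 1 0 +
    (s i == 2)%:R * u 2 0) + (t i)%:~R * (u 0 0 + u 1 0 + u 2 0)); first by ring.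
  by rewrite hu mulr0 addr0.
rewrite /dot [RHS](reindex_inj (@perm_inj _ s)); apply: eq_bigr => i _.
by rewrite !E mulrACA ee mul1r.
Qed.

Lemma inG_reflection_mirrors g v : inG g -> \det g = -1 -> planeA v ->
  g *m v = v -> mirrors v.
Proof.
move=> /inG_Gform[e [s [t Gg]]] dg hv /colP fv; split=> //.
have [d1|[_ [i [j [k [[si sj sk] [ij ik jk]]]]]]] := Gform_det Gg.
  by exfalso; lra.
have fi := fv i; have fk := fv k; have [he ht _] := Gg.
rewrite (Gform_mulv _ Gg) // si in fi; rewrite (Gform_mulv _ Gg) // sk in fk.
case: he fi fk => -> fi fk.
  have {fk}fi : v i 0 - v j 0 = (t i)%:~R by lra.
  have fi' : v j 0 - v i 0 = (- t i)%:~R by rewrite rmorphN /=; lra.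
  (* [mirrors] lists each difference of coordinates in one order only. *)
  case: (leqP i j) => lij; [exists (t i)|exists (- t i)];
    move: i j {si sj ik jk} ij lij fi fi'; elim/forall_ord3;
        elim/forall_ord3 => //= *; tauto.
(* The fixed index only yields 2 v_k = t_k. Integrality of v_k comes from v_i + v_j = t_i and the
   coordinate sum 1. *)
exists (1 - t i); have : v k 0 = (1 - t i)%:~R.
  have : v i 0 + v j 0 + v k 0 = 1.
    rewrite -[RHS]hv => {si sj sk fi fk}.
    move: i j k ij ik jk.
    by elim/forall_ord3; elim/forall_ord3; elim/forall_ord3 => // _ _ _; ring.
  rewrite rmorphB /=; lra.
by move: k {sk fk ik jk}; elim/forall_ord3; tauto.
Qed.

Definition intD v := planeA v /\ (0 < v 2 0) && (v 2 0 < v 1 0) && (v 1 0 < v 0 0).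

Lemma intD_domD v : intD v -> domD v.
Proof. by move=> [hv h]; split=> //; lra. Qed.

(** In the open triangle the six functions defining the mirrors take values strictly between 0 and
    1. *)
Lemma intD_mirrors v : intD v -> ~ mirrors v.
Proof.
move=> [hv h] [_ [n hn]]; move: hv; rewrite /planeA /= => hv.
have /andP[] : 0 < (n%:~R : R) < 1 by move: hn => [|[|[|[|[|]]]]]; lra.
by rewrite ltr0z ltrz1; lia.
Qed.

Lemma int_between (n : int) (a : int) : (a - 1)%:~R < (n%:~R : R) < (a + 2)%:~R ->
  n = a \/ n = a + 1.
Proof. rewrite !ltr_int; lia. Qed.

(** For e = -1, t_i is a sum of two coordinates, all of them in ]0, 1[, hence t_i = 1, against the
    total 2 of [t]. For e = 1, t_i is a difference of such coordinates, hence 0, and [s] is trivial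
    because the coordinates are distinct. *)
Lemma intD_stab g v : inG g -> intD v -> g *m v = v -> g = 1%:M.
Proof.
move=> /inG_Gform[e [s [t Gg]]] [hv h] /colP fv.
have F i : v i 0 = e * v (s i) 0 + (t i)%:~R by rewrite -[LHS]fv (Gform_mulv _ Gg).
have [he ht hg] := Gg; have hv' := hv; rewrite /planeA /= in hv'.
have B : forall i, 0 < v i 0 < 1 by elim/forall_ord3; lra.
have inj : forall i j, v i 0 = v j 0 -> i = j.
  by elim/forall_ord3; elim/forall_ord3 => // E; exfalso; lra.
case: he => ee; last first.
  have T i : t i = 1.
    have [] // := @int_between (t i) 0; have := F i; have := B i; have := B (s i).
    - rewrite ee /=; lra.
    - by move=> ? ? ? t0; exfalso; move: (F i) (B i) (B (s i));
        rewrite ee t0 ?add0r ?mulr0z ?mulr1z; lra.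
  by exfalso; move: ht; rewrite !T ee !rmorphD /=; lra.
have T i : t i = 0.
  have [] // := @int_between (t i) 0; have := F i; have := B i; have := B (s i).
  - rewrite ee /=; lra.
  - by move=> ? ? ? t0; exfalso; move: (F i) (B i) (B (s i));
      rewrite ee t0 ?add0r ?mulr0z ?mulr1z; lra.
apply/matrixP=> i j; rewrite hg ee T addr0 mul1r mxE.
by rewrite [s i](inj _ i) //; have := F i; rewrite ee T; lra.
Qed.

(** The last two coordinates of a point of D are at most 1/2, which leaves two values for each of
    [t 1] and [t 2]. The sum determines [t 0], and finitely many linear systems remain. *)
Lemma domD_unique g v w : inG g -> domD v -> domD w -> w = g *m v -> w = v.
Proof.
move=> /inG_Gform[e [s [t Gg]]] [hv h] [hw h'] E.
have F i : w i 0 = e * v (s i) 0 + (t i)%:~R by rewrite E (Gform_mulv _ Gg).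
have [he ht _] := Gg; move: (hv) (hw); rewrite /planeA /= => hv' hw'.
move: ht; rewrite !rmorphD /= => ht.
have T0 : t 0 = (if e == 1 then 0 else 2) - t 1 - t 2.
  apply: (@intr_inj R); rewrite !rmorphB /=.
  case: he ht => ->; rewrite ?eqxx; first lra.
  by rewrite lt_eqF; lra.
have [a [ha T1 T2]] : exists a : int, [/\ e = 1 /\ a = -1 \/ e = -1 /\ a = 0,
    t 1 = a \/ t 1 = a + 1 & t 2 = a \/ t 2 = a + 1].
  have B : forall i, 0 <= v i 0 <= 1 by elim/forall_ord3; lra.
  have := (F 1, F 2, B (s 1), B (s 2)).
  case: he => -> [[[F1 F2] B1] B2]; [exists (-1)|exists 0].
    by split; [left|apply: int_between|apply: int_between] => //=; lra.
  by split; [right|apply: int_between|apply: int_between] => //=; lra.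
have := F 2; have := F 1; have := F 0; rewrite {F E Gg ht he}T0.
case: ha => -[-> ->] in T1 T2 *; rewrite ?eqxx ?(@lt_eqF _ _ (-1) 1) //;
case: T1 => ->; case: T2 => ->; rewrite !rmorphB ?rmorphD ?rmorphN /=;
case: (perm3_cases s) => [[][-> -> ->]|[-> -> ->]|[-> -> ->]|[-> -> ->]];
by move=> F0 F1 F2; apply: cV3P; lra.
Qed.

End Geometry.

(** * Conjugation by an angle transition matrix *)

Section Conjugation.
Variable R : realType.
Implicit Types (u v w : 'cV[R]_3) (M N g h : 'M[R]_3).

Lemma countable_inG : countable [set g : 'M[R]_3 | inG g].
Proof.
pose k (x : bool * 'S_3 * {ffun 'I_3 -> int}) : 'M[R]_3 :=
  \matrix_(i, j) ((-1) ^+ x.1.1 * (x.1.2 i == j)%:R + (x.2 i)%:~R).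
have : countable (range k) by exact: (sub_countable (card_image_le _ _) (countableP
    _)).
apply: sub_countable; apply: subset_card_le => g.
move=> /inG_Gform[e [s [t [he _ hg]]]].
exists (e != 1, s, [ffun i => t i]) => //.
apply/matrixP => i j; rewrite mxE hg ffunE /=; congr (_ * _ + _).
case: he => ->; rewrite ?eqxx ?expr0 //.
by rewrite lt_eqF ?expr1 //; lra.
Qed.

Lemma quadratic_three_roots (a b c s1 s2 s3 : R) :
  s1 != s2 -> s1 != s3 -> s2 != s3 ->
  (forall s, s \in [:: s1; s2; s3] -> a * s + b * (s * s) + c = 0) ->
  [/\ a = 0, b = 0 & c = 0].
Proof.
move=> h12 h13 h23 H; rewrite -subr_eq0 in h12; rewrite -subr_eq0 in h13.
rewrite -subr_eq0 in h23.
have H1 : a * s1 + b * (s1 * s1) + c = 0 by apply: H; rewrite !inE eqxx.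
have H2 : a * s2 + b * (s2 * s2) + c = 0 by apply: H; rewrite !inE eqxx orbT.
have H3 : a * s3 + b * (s3 * s3) + c = 0 by apply: H; rewrite !inE eqxx !orbT.
have E12 : a + b * (s1 + s2) = 0.
  apply: (mulfI h12); rewrite mulr0.
  transitivity ((a * s1 + b * (s1 * s1) + c) - (a * s2 + b * (s2 * s2) + c));
      first by ring.
  by rewrite H1 H2 subrr.
have E13 : a + b * (s1 + s3) = 0.
  apply: (mulfI h13); rewrite mulr0.
  transitivity ((a * s1 + b * (s1 * s1) + c) - (a * s3 + b * (s3 * s3) + c));
      first by ring.
  by rewrite H1 H3 subrr.
have b0 : b = 0.
  apply: (mulfI h23); rewrite mulr0.
  transitivity ((a + b * (s1 + s2)) - (a + b * (s1 + s3))); first by ring.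
  by rewrite E12 E13 subrr.
by move: E12 H1; rewrite b0 !mul0r addr0 => ->; rewrite mul0r !add0r => ->.
Qed.

(** A parabola in the plane: no three of its points are collinear, so any three of them span R^3. *)
Definition curve (s : R) : 'cV[R]_3 := vec3 s (s * s) (1 - s - s * s).

Lemma curve_planeA s : planeA (curve s).
Proof. by rewrite /planeA /= !vec3E; ring. Qed.

Lemma curve_span N s1 s2 s3 : s1 != s2 -> s1 != s3 -> s2 != s3 ->
  (forall s, s \in [:: s1; s2; s3] -> N *m curve s = 0) -> N = 0.
Proof.
move=> h12 h13 h23 H; apply/matrixP => i j; rewrite [RHS]mxE.
have [|e0 e1 e2] := @quadratic_three_roots (N i 0 - N i 2) (N i 1 - N i 2)
  (N i 2) _ _ _ h12 h13 h23.
  move=> s /H /colP/(_ i); rewrite mulmx_cV3 !vec3E [RHS]mxE => <-; ring.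
by move: j; elim/forall_ord3 => //; lra.
Qed.

Lemma ATM_conj M g : ATM M -> inG g -> exists2 g', inG g' & M *m g = g' *m M.
Proof.
move=> [uM AM HM] Gg; apply: contrapT => /forall2NP no.
(* The parameters at which [g'] serves. If no element conjugates [g], each of these sets has at most
   two points, and their countable union has measure 0; but it is the whole line. *)
pose S (g' : 'M[R]_3) := [set s : R | M *m (g *m curve s) = g' *m (M *m curve s)].
have cS g' : inG g' -> countable (S g').
  move=> Gg'.
  suff [s1 [s2 sub]] : exists s1 s2, S g' `<=` [set s1; s2].
    by apply: sub_countable (subset_card_le sub) _; exact: finite_set_countable.
  have [[s1 h1]|] := pselect (exists s, S g' s); last first.
    by move=> no1; exists 0, 0 => s hs; exfalso; apply: no1; exists s.
  have [[s2 [h2 n12]]|] := pselect (exists s, S g' s /\ s1 != s); last first.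
    move=> no1; exists s1, s1 => s hs; left; apply: contrapT => /eqP ns.
    by apply: no1; exists s; rewrite eq_sym.
  exists s1, s2 => s hs; apply: contrapT => /not_orP[/eqP n1 /eqP n2].
  have : M *m g - g' *m M = 0.
    apply: (@curve_span _ s1 s2 s) => //; rewrite 1?eq_sym //.
    move=> x; rewrite !inE => /or3P[] /eqP ->;
     by rewrite mulmxBl -!mulmxA ?h1 ?h2 ?hs subrr.
  by move/eqP; rewrite subr_eq0 => /eqP; case: (no g').
have : countable (\bigcup_(g' in [set g | inG g]) S g').
  by apply: bigcup_countable => //; exact: countable_inG.
move/countable_lebesgue_measure0.
rewrite (_ : \bigcup_(_ in _) _ = setT);
    first by rewrite -set_itvNyy lebesgue_measure_itv.
apply/seteqP; split=> // s _.
have [] := HM (curve s) (g *m curve s) (curve_planeA s).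
- by apply: planeA_affmx; [exact: inG_aff|exact: curve_planeA].
- by exists g.
- by move=> g' Gg' E; exists g'.
Qed.

Lemma ATM_aff M : ATM M -> affmx M.
Proof. by case=> _ /affmx_planeA. Qed.

Definition sum0 u := u 0 0 + u 1 0 + u 2 0 = 0.

Lemma sum0_aff N u : affmx N -> sum0 u -> sum0 (N *m u).
Proof.
move=> hN; rewrite /sum0 !mulmx_cV3 => hu; rewrite -[RHS]hu.
have := hN 0; have := hN 1; have := hN 2 => h2 h1 h0.
rewrite -[u 0 0 in RHS]mul1r -[u 1 0 in RHS]mul1r -[u 2 0 in RHS]mul1r.
rewrite -{1}h0 -{1}h1 -{1}h2; ring.
Qed.

Lemma dotE u v : dot u v = u 0 0 * v 0 0 + u 1 0 * v 1 0 + u 2 0 * v 2 0.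
Proof. by rewrite /dot big_ord3. Qed.

Lemma tperm_mulmx (i j k : 'I_3) v : (tperm_mx i j *m v) k 0 = v (tperm i j k) 0.
Proof. by rewrite -row_permE mxE. Qed.

Lemma ATM_similar M u : ATM M -> sum0 u ->
  dot (M *m u) (M *m u) = `|\det M| * dot u u.
Proof.
move=> AM hu; have hM := ATM_aff AM.
have B g w : inG g -> sum0 w -> dot (M *m (g *m w)) (M *m (g *m w)) = dot (M *m w)
    (M *m w).
  move=> /(ATM_conj AM)[g' Gg' E] hw.
  by rewrite !mulmxA E -mulmxA inG_isom //; exact: sum0_aff.
have T (i j : 'I_3) w k : (tperm_mx i j *m w) k 0 = w (tperm i j k) 0 :> R by
    exact: tperm_mulmx.
(* The transpositions send these differences of basis vectors to further ones: the images under M of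
   all three differences have the same length, which determines the quadratic form. *)
have := B _ (vec3 0 1 (-1)) (inG_P13 R); have := B _ (vec3 1 0 (-1)) (inG_P23 R).
rewrite !dotE ![(M *m _) _ 0]mulmx_cV3 !T !permE /= !vec3E /sum0 !vec3E.
move=> /(_ ltac:(lra)) H1 /(_ ltac:(lra)) H2.
rewrite det3.
have m0 : M 2 0 = 1 - M 0 0 - M 1 0 by have := hM 0; lra.
have m1 : M 2 1 = 1 - M 0 1 - M 1 1 by have := hM 1; lra.
have m2 : M 2 2 = 1 - M 0 2 - M 1 2 by have := hM 2; lra.
have hu2 : u 2 0 = - u 0 0 - u 1 0 by move: hu; rewrite /sum0; lra.
move: H1 H2; rewrite m0 m1 m2 hu2 => H1 H2.
(* The matrix of M on the vectors of sum 0, in the basis e0 - e2, e1 - e2. *)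
set p := M 0 0 - M 0 2; set q := M 0 1 - M 0 2.
set r := M 1 0 - M 1 2; set s := M 1 1 - M 1 2.
(* Half of |M u|^2 is a quadratic form in the first two coordinates of [u]; its three coefficients
   coincide. *)
have E1 : q * q + q * s + s * s = p * p + p * r + r * r by rewrite /p /q /r /s; lra.
have E2 : 2 * p * q + p * s + q * r + 2 * r * s = p * p + p * r + r * r by rewrite
    /p /q /r /s; lra.
have -> : M 0 0 * (M 1 1 * (1 - M 0 2 - M 1 2) - M 1 2 * (1 - M 0 1 - M 1 1)) -
   M 0 1 * (M 1 0 * (1 - M 0 2 - M 1 2) - M 1 2 * (1 - M 0 0 - M 1 0)) +
   M 0 2 * (M 1 0 * (1 - M 0 1 - M 1 1) - M 1 1 * (1 - M 0 0 - M 1 0)) = p * s - q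
       * r.
  by rewrite /p /q /r /s; ring.
have -> : `|p * s - q * r| = p * p + p * r + r * r.
  apply/eqP; rewrite -(@eqrXn2 _ 2) //; last by nra.
  rewrite real_normK ?num_real //; apply/eqP.
  (* The form is X^2 + X Y + Y^2, of discriminant -3, composed with this matrix, so its discriminant
     is -3 (p s - q r)^2. *)
  apply: (@mulfI _ 3); first by lra.
  transitivity (4 * (p * p + p * r + r * r) * (q * q + q * s + s * s) -
   (2 * p * q + p * s + q * r + 2 * r * s) ^+ 2); first by ring.
  by rewrite E1 E2; ring.
move: (u 0 0) (u 1 0) => x y.
transitivity (2 * ((p * p + p * r + r * r) * (x * x) +
  (2 * p * q + p * s + q * r + 2 * r * s) * (x * y) + (q * q + q * s + s * s) * (y
      * y))).
  by rewrite /p /q /r /s; ring.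
by rewrite E1 E2; ring.
Qed.

End Conjugation.

(** * The triangle D and its image *)

Section Chambers.
Variable R : realType.
Implicit Types (u v w p : 'cV[R]_3) (M N g h : 'M[R]_3).

(** The vertices of D with angles of 30, 60 and 90 degrees, in this order. *)
Definition vA : 'cV[R]_3 := vec3 1 0 0.
Definition vB : 'cV[R]_3 := vec3 (1 / 3) (1 / 3) (1 / 3).
Definition vC : 'cV[R]_3 := vec3 (1 / 2) (1 / 2) 0.
(** The centroid of the three vertices, the test point of D and of its images. *)
Definition center : 'cV[R]_3 := vec3 (11 / 18) (5 / 18) (1 / 9).

(** Linear forms of the sides: [wall 0], [wall 1], [wall 2] vanish on the sides opposite to [vA],
    [vC], [vB]. *)
Definition wall (k : 'I_3) v : R :=
  nth 0 [:: v 0 0 - v 1 0; v 1 0 - v 2 0; v 2 0] k.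

Definition wall_refl (k : 'I_3) : 'M[R]_3 :=
  nth 0 [:: tperm_mx 0 1; tperm_mx 1 2; flip3 R] k.

Lemma domDP v : domD v <-> planeA v /\ forall k, 0 <= wall k v.
Proof.
split=> -[hv h]; split=> //; first by elim/forall_ord3; rewrite /wall /=; lra.
by have := (h 0, h 1, h 2) => -[[]]; rewrite /wall /=; lra.
Qed.

Lemma intDP v : intD v <-> planeA v /\ forall k, 0 < wall k v.
Proof.
split=> -[hv h]; split=> //; first by elim/forall_ord3; rewrite /wall /=; lra.
by have := (h 0, h 1, h 2) => -[[]]; rewrite /wall /=; lra.
Qed.

Lemma planeA_conv (s : R) v w : planeA v -> planeA w ->
  planeA ((1 - s) *: v + s *: w).
Proof.
rewrite /planeA /= !mxE => hv hw.
by rewrite -[RHS]mulr1 -[in LHS]hv; nra.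
Qed.

Lemma wall_conv k (s : R) v w :
  wall k ((1 - s) *: v + s *: w) = (1 - s) * wall k v + s * wall k w.
Proof. by move: k; elim/forall_ord3; rewrite /wall /= !mxE; ring. Qed.

Lemma domD_conv (s : R) v w : 0 <= s <= 1 -> domD v -> domD w ->
  domD ((1 - s) *: v + s *: w).
Proof.
move=> hs /domDP[hv Hv] /domDP[hw Hw]; apply/domDP.
split=> [|k]; first exact: planeA_conv.
by rewrite wall_conv; have := Hv k; have := Hw k; nra.
Qed.

Lemma intD_conv (s : R) v w : 0 <= s < 1 -> intD v -> domD w ->
  intD ((1 - s) *: v + s *: w).
Proof.
move=> hs /intDP[hv Hv] /domDP[hw Hw]; apply/intDP.
split=> [|k]; first exact: planeA_conv.
by rewrite wall_conv; have := Hv k; have := Hw k; nra.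
Qed.

Lemma center_intD : intD center.
Proof. by split; rewrite /planeA /= !vec3E; lra. Qed.

Lemma vA_domD : domD vA. Proof. by split; rewrite /planeA /= !vec3E; lra. Qed.
Lemma vB_domD : domD vB. Proof. by split; rewrite /planeA /= !vec3E; lra. Qed.
Lemma vC_domD : domD vC. Proof. by split; rewrite /planeA /= !vec3E; lra. Qed.

Lemma domD_triangle : @domD R = triangle vA vB vC.
Proof.
apply/seteqP; split=> [v [hv h]|v [r [s [t [r0 s0 t0 e ->]]]]].
  (* Barycentric coordinates: each wall form divided by its value at the opposite vertex. *)
  exists (wall 0 v), (3 * v 2 0), (2 * wall 1 v).
  move: hv; rewrite /planeA /wall /= => hv.
  by split; [lra|lra|lra|lra|apply: cV3P; rewrite !mxE /=; lra].
by split; rewrite /planeA /= !mxE /=; lra.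
Qed.

Lemma inG_wall_refl k : inG (wall_refl k).
Proof.
move: k; elim/forall_ord3; rewrite /wall_refl /=; [|exact: inG_P23|exact: inG_flip].
have -> : tperm_mx 0 1 = tperm_mx 0 2 *m (tperm_mx 1 2 *m tperm_mx 0 2) :> 'M[R]_3.
  rewrite -!perm_mxM; congr perm_mx; apply/permP => i; rewrite !permM.
  by move: i; elim/forall_ord3; rewrite !permE.
by apply: inG_mul; [exact: inG_P13|apply: inG_mul; [exact: inG_P23|exact: inG_P13]].
Qed.

Lemma det_wall_refl k : \det (wall_refl k) = -1.
Proof.
move: k; elim/forall_ord3; rewrite /wall_refl /= ?det_perm ?odd_tperm //.
by rewrite det3 !mxE /=; ring.
Qed.

Lemma wall_refl_fix k v : wall k v = 0 -> wall_refl k *m v = v.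
Proof.
move: k; elim/forall_ord3; rewrite /wall /wall_refl /= => h; apply: cV3P;
  by rewrite ?tperm_mulmx ?permE ?mulmx_cV3 ?mxE /=; lra.
Qed.

Lemma ATM_wall_refl M k v : ATM M -> planeA v -> wall k v = 0 ->
  exists g, [/\ inG g, \det g = -1 & g *m (M *m v) = M *m v].
Proof.
move=> AM hv h; have [g Gg E] := ATM_conj AM (inG_wall_refl k).
exists g; split=> //; last by rewrite mulmxA -E -mulmxA wall_refl_fix.
have [uM _ _] := AM; have dM : \det M != 0 by rewrite -unitfE -unitmxE.
by apply: (mulIf dM); rewrite -det_mulmx -E det_mulmx det_wall_refl mulrC.
Qed.

Lemma ATM_wall_mirrors M k v : ATM M -> planeA v -> wall k v = 0 ->
  mirrors (M *m v).
Proof.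
move=> AM hv h; have [g [Gg dg E]] := ATM_wall_refl AM hv h.
apply: inG_reflection_mirrors Gg dg _ E.
exact: planeA_affmx (ATM_aff AM) hv.
Qed.

Lemma segm_wall M k v w : ATM M -> planeA v -> planeA w ->
  wall k v = 0 -> wall k w = 0 -> segm (M *m v) (M *m w) `<=` @mirrors R.
Proof.
move=> AM hv hw kv kw _ [s hs ->].
rewrite !scalemxAr -mulmxDr; apply: (ATM_wall_mirrors (k := k)) => //.
  exact: planeA_conv.
by rewrite wall_conv kv kw !mulr0 addr0.
Qed.

Lemma image_triangle M a b c :
  mulmx M @` triangle a b c = triangle (M *m a) (M *m b) (M *m c).
Proof.
apply/seteqP; split=> [_ [_ [r [s [t [r0 s0 t0 e ->]]]] <-]|_ [r [s [t [r0 s0 t0 e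
    ->]]]]].
  by exists r, s, t; split=> //; rewrite !mulmxDr !scalemxAr.
exists (r *: a + s *: b + t *: c); last by rewrite !mulmxDr !scalemxAr.
by exists r, s, t.
Qed.

(** Polarization of [ATM_similar]. *)
Lemma ATM_dot M u v : ATM M -> sum0 u -> sum0 v ->
  dot (M *m u) (M *m v) = `|\det M| * dot u v.
Proof.
move=> AM hu hv.
have hs : sum0 (u + v) by move: hu hv; rewrite /sum0 !mxE; lra.
have := ATM_similar AM hs; rewrite mulmxDr.
have := ATM_similar AM hu; have := ATM_similar AM hv.
move: (M *m u) (M *m v) `|\det M| => u' v' c; rewrite !dotE !mxE.
nra.
Qed.

(** With c this cosine, the triple angle formula reads 4 c^3 - 3 c = cos (pi / 2) = 0, and c > 0. *)
Lemma cos_pi6 : 0 <= cos (pi / 6 : R) /\ cos (pi / 6 : R) ^+ 2 = 3 / 4.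
Proof.
have pi0 := @pi_gt0 R.
have c0 : 0 < cos (pi / 6 : R) by apply: cos_gt0_pihalf; lra.
split; first exact: ltW.
have : cos (pi / 6 + (pi / 6 + pi / 6) : R) = 0.
  by rewrite -[RHS]cos_pihalf; congr cos; field.
have := cos2Dsin2 (pi / 6 : R).
rewrite !cosD sinD => h e.
have : cos (pi / 6 : R) * (4 * cos (pi / 6) ^+ 2 - 3) = 0.
  rewrite -e; move: h; move: (cos _) (sin _) => c s h.
  have -> : 3 = 3 * (c ^+ 2 + s ^+ 2) by rewrite h mulr1.
  ring.
by move/eqP; rewrite mulf_eq0 gt_eqF //= => /eqP; lra.
Qed.

Lemma cos_pi3 : cos (pi / 3 : R) = 1 / 2.
Proof.
have [_ h] := cos_pi6; rewrite (_ : pi / 3 = pi / 6 + pi / 6 :> R); last by field.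
by rewrite cosD; have := cos2Dsin2 (pi / 6 : R); rewrite !expr2 in h *; lra.
Qed.

(** When both cosines are nonnegative it suffices to compare their squares, which removes the square
    roots of [enorm]. *)
Lemma angleE a b c (th : R) : 0 <= th <= pi -> 0 <= cos th ->
  0 < dot (b - a) (b - a) -> 0 < dot (c - a) (c - a) -> 0 <= dot (b - a) (c - a) ->
  dot (b - a) (c - a) ^+ 2 = cos th ^+ 2 * (dot (b - a) (b - a) * dot (c - a) (c -
      a)) ->
  angle a b c = th.
Proof.
move=> hth cth bb cc bc e; rewrite /angle -[RHS]cosK ?in_itv //; congr acos.
rewrite /enorm -sqrtrM ?ltW //.
apply/eqP; rewrite -(@eqrXn2 _ 2) //; last by rewrite divr_ge0 ?sqrtr_ge0.
rewrite expr_div_n sqr_sqrtr ?mulr_ge0 ?ltW // e mulfK //.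
by rewrite mulf_neq0 ?gt_eqF.
Qed.

Lemma ATM_triangle_30_60_90 M : ATM M ->
  triangle_30_60_90 (M *m vA) (M *m vB) (M *m vC).
Proof.
move=> AM; have pi0 := @pi_gt0 R.
have [uM _ _] := AM; have dM : 0 < `|\det M| by rewrite normr_gt0 -unitfE -unitmxE.
have [c6 c6E] := cos_pi6.
have S u v : planeA u -> planeA v -> sum0 (u - v) by rewrite /planeA /sum0 /= !mxE;
    lra.
have pA : planeA vA by case: vA_domD.
have pB : planeA vB by case: vB_domD.
have pC : planeA vC by case: vC_domD.
have ge0 (x : R) : 0 <= x -> 0 <= `|\det M| * x by exact: mulr_ge0 (ltW dM).
have gt0 (x : R) : 0 < x -> 0 < `|\det M| * x by exact: mulr_gt0.
by split; apply: angleE; rewrite ?cos_pi3 ?cos_pihalf -?mulmxBr ?(ATM_dot AM) ?c6E;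
    try apply: S => //;
  rewrite ?dotE ?mxE /=; try (apply: ge0); try (apply: gt0); try lra; field.
Qed.

End Chambers.

(** * Closed sets, segments and relative interiors *)

Section Topology.
Variable R : realType.
Implicit Types (u v w p c : 'cV[R]_3) (M N g h : 'M[R]_3).

Lemma cvg_mx (T : Type) (F : set_system T) (FF : Filter F) m n
    (u : T -> 'M[R]_(m, n)) (l : 'M[R]_(m, n)) :
  (forall i j, u x i j @[x --> F] --> l i j) -> u x @[x --> F] --> l.
Proof.
move=> H A [P hP sPA].
have : \forall x \near F, forall i j, P i j (u x i j).
  apply: filter_forall => i; apply: filter_forall => j.
  exact: H (hP i j).
by apply: filterS => x Px; apply: sPA.
Qed.

Lemma continuous_mulmx N : continuous (mulmx N : 'cV[R]_3 -> 'cV[R]_3).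
Proof.
move=> v; apply: (@cvg_mx _ (nbhs v) _) => i j.
rewrite ord1 mulmx_cV3; under eq_fun do rewrite mulmx_cV3.
by apply: cvgD; [apply: cvgD|]; apply: cvgMl_tmp; exact: coord_continuous.
Qed.

(** Interiors enter the tiling arguments through segments: a neighbourhood of [v] contains the
    beginning of every segment issued from [v]. *)
Lemma near_conv v c (A : set 'cV[R]_3) : nbhs v A ->
  exists2 e : R, 0 < e & forall s, 0 <= s < e -> A ((1 - s) *: v + s *: c).
Proof.
move=> vA; have : ((1 - s) *: v + s *: c) @[s --> (0 : R)] --> v.
  have E : v = (1 - 0) *: v + 0 *: c by rewrite subr0 scale1r scale0r addr0.
  rewrite [X in _ --> X]E.
  apply: cvgD; apply: cvgZr_tmp; last exact: cvg_id.
  by apply: cvgB; [exact: cvg_cst|exact: cvg_id].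
move=> /(_ _ vA) /nbhs_ballP[e e0 He]; exists e => // s hs.
by apply: He; rewrite /ball /= sub0r normrN ger0_norm; lra.
Qed.

Lemma closed_domD : closed (@domD R).
Proof.
have cc i : continuous (fun v : 'cV[R]_3 => v i 0) by exact: coord_continuous.
have -> : @domD R = [set v | v 0 0 + v 1 0 + v 2 0 = 1] `&`
  ([set v | 0 <= v 2 0] `&` ([set v | 0 <= v 1 0 - v 2 0] `&` [set v | 0 <= v 0 0 -
      v 1 0])).
  apply/seteqP; split=> v; first by case; rewrite /planeA /= => ? ?; do !split;
      rewrite /=; lra.
  by case=> /= ? [/= ? [/= ? /= ?]]; split; rewrite /planeA /=; lra.
apply: closedI; [|apply: closedI; [|apply: closedI]].
- apply: (@preimage_closed _ _ (fun v => v 0 0 + v 1 0 + v 2 0) [set 1]);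
    last exact: closed_eq.
  by move=> v _; apply: (continuousD (continuousD (cc 0 v) (cc 1 v)) (cc 2 v)).
- by apply: (@preimage_closed _ _ (fun v => v 2 0) [set x | 0 <= x]); [move=> v _;
    exact: cc|exact: closed_ge].
- apply: (@preimage_closed _ _ (fun v => v 1 0 - v 2 0) [set x | 0 <= x]);
    last exact: closed_ge.
  by move=> v _; apply: (continuousB (cc _ v) (cc _ v)).
- apply: (@preimage_closed _ _ (fun v => v 0 0 - v 1 0) [set x | 0 <= x]);
    last exact: closed_ge.
  by move=> v _; apply: (continuousB (cc _ v) (cc _ v)).
Qed.

Lemma closed_preimage_mulmx N (S : set 'cV[R]_3) : closed S ->
  closed [set v | S (N *m v)].
Proof.
by apply: preimage_closed => v _; exact: continuous_mulmx.
Qed.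

Lemma relint_sub (X S : set 'cV[R]_3) : relint X S `<=` S.
Proof. by move=> v [Xv /nbhs_singleton]; apply. Qed.

Lemma relint_conv (X S : set 'cV[R]_3) v c :
  relint X S v -> (forall s, 0 <= s < 1 -> X ((1 - s) *: v + s *: c)) ->
  exists2 e : R, 0 < e & forall s, 0 <= s < e -> S ((1 - s) *: v + s *: c).
Proof.
move=> [_ /(@near_conv _ c)[e e0 He]] HX; exists (Num.min e 1).
  by rewrite lt_min e0 ltr01.
move=> s; rewrite lt_min => /and3P[s0 se s1].
by apply: He; [rewrite s0|apply: HX; rewrite s0].
Qed.

End Topology.

(** * The chambers tiling M D *)

Section Tiles.
Variable R : realType.
Implicit Types (u v w p q : 'cV[R]_3) (M N g h : 'M[R]_3).

(** The inverse branch of [f] attached to the chamber g D, when this chamber lies in M D. *)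
Definition phi M g := invmx M *m g.

Lemma ATM_unit M : ATM M -> M \in unitmx. Proof. by case. Qed.

Lemma phi_aff M g : ATM M -> inG g -> affmx (phi M g).
Proof.
move=> AM Gg; apply: affmxM; last exact: inG_aff.
by apply: affmx_inv; [exact: ATM_unit|exact: ATM_aff].
Qed.

Lemma mulmx_phi M g v : ATM M -> M *m (phi M g *m v) = g *m v.
Proof. by move=> /ATM_unit uM; rewrite /phi -mulmxA mulKVmx. Qed.

(* Otherwise the conjugate by M of the reflection in this wall would fix the
   interior point g p of the chamber g D.                                    *)
Lemma phi_wall_neq0 M g k p : ATM M -> inG g -> intD p ->
  wall k (phi M g *m p) <> 0.
Proof.
move=> AM Gg ip h; have [hp _] := ip.
have [r [Gr dr]] := ATM_wall_refl AM (planeA_affmx (phi_aff AM Gg) hp) h.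
rewrite mulmx_phi // => E.
apply: (intD_mirrors ip).
apply: (@inG_reflection_mirrors _ (invmx g *m (r *m g))) => //.
- by apply: inG_mul; [exact: inG_inv|exact: inG_mul].
- rewrite !det_mulmx dr det_inv mulN1r mulrN mulVf //.
  by rewrite -normr_gt0 inG_det.
- by rewrite -!mulmxA E mulKmx //; exact: inG_unit.
Qed.

(** If the wall form changed sign between the images of the center and of [p], it would vanish at
    the image of a point of the segment other than [p]. Such a point is interior to D even when [p]
    is not, against [phi_wall_neq0]. *)
Lemma wall_phi_sign M g k p : ATM M -> inG g -> domD p ->
  ~ wall k (phi M g *m center R) * wall k (phi M g *m p) < 0.
Proof.
move=> AM Gg hp hlt; set a := wall _ _ in hlt; set b := wall _ _ in hlt.
have [s [s0 s1 e]] : exists s : R, [/\ 0 <= s, s < 1 & (1 - s) * a + s * b = 0].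
  have ab : a - b != 0 by apply/eqP => ab; move: hlt; rewrite (_ : b = a); [nra|lra].
  have ba : a * b / (a - b) ^+ 2 <= 0.
    by apply: mulr_le0_ge0; [exact: ltW|rewrite invr_ge0 sqr_ge0].
  exists (a / (a - b)); split; last by field.
    rewrite (_ : a / (a - b) = a * (a - b) / (a - b) ^+ 2); last by field.
    by apply: divr_ge0; [nra|exact: sqr_ge0].
  rewrite -subr_gt0 (_ : 1 - _ = (b * b - a * b) / (a - b) ^+ 2); last by field.
  apply: divr_gt0; last by rewrite exprn_even_gt0.
  by have := sqr_ge0 b; rewrite expr2; nra.
have := @phi_wall_neq0 M g k ((1 - s) *: center R + s *: p) AM Gg.
rewrite mulmxDr -!scalemxAr wall_conv e; apply=> //.
by apply: intD_conv => //; [rewrite s0 s1|exact: center_intD].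
Qed.

Lemma tile_sub M g p : ATM M -> inG g -> intD (phi M g *m center R) ->
  domD p -> domD (phi M g *m p).
Proof.
move=> AM Gg /intDP[_ hc] hp; apply/domDP; split.
  by apply: planeA_affmx; [exact: phi_aff|case: hp].
move=> k; have := @wall_phi_sign M g k p AM Gg hp; have := hc k.
by move=> h1 h2; rewrite leNgt; apply/negP => h3; apply: h2; nra.
Qed.

(** Together with [tile_sub], this lets the center decide: a chamber that meets the interior of M D
    has its center there, and then lies entirely in M D. *)
Lemma tile_out M g p : ATM M -> inG g -> domD p -> intD (phi M g *m p) ->
  intD (phi M g *m center R).
Proof.
move=> AM Gg hp /intDP[_ ip]; apply/intDP; split.
  apply: planeA_affmx; first exact: phi_aff.
  by case: (center_intD R).
move=> k; have := @wall_phi_sign M g k p AM Gg hp; have := ip k.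
have := @phi_wall_neq0 M g k _ AM Gg (center_intD R).
move=> /eqP h0 h1 h2; rewrite lt_neqAle eq_sym h0 /= leNgt.
by apply/negP => h3; apply: h2; nra.
Qed.

(** Both [p] and [q] represent the same orbit in D, so they are equal, and the stabilizer of an
    interior point is trivial. *)
Lemma tile_key g h p q : inG g -> inG h -> intD p -> domD q ->
  g *m p = h *m q -> g = h.
Proof.
move=> Gg Gh ip dq E.
have ug := inG_unit Gg; have uh := inG_unit Gh.
have Ghg : inG (invmx h *m g) by apply: inG_mul => //; exact: inG_inv.
have Eq : q = (invmx h *m g) *m p by rewrite -mulmxA E mulKmx.
have pq := domD_unique Ghg (intD_domD ip) dq Eq.
have : invmx h *m g = 1%:M by apply: (intD_stab Ghg ip); rewrite -Eq.
by move/(congr1 (mulmx h)); rewrite mulKVmx // mulmx1.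
Qed.

Definition tile_family (I : finType) M (g : I -> 'M[R]_3) :=
  [/\ forall i, inG (g i), injective g,
      forall i, intD (phi M (g i) *m center R) &
      forall h, inG h -> intD (phi M h *m center R) -> exists i, h = g i].

Section Family.
Variables (I : finType) (M : 'M[R]_3) (g : I -> 'M[R]_3).
Variable f : 'cV[R]_3 -> 'cV[R]_3.
Hypotheses (AM : ATM M) (hf : linear_triangle_map M f) (tg : tile_family M g).

Definition piece i : set 'cV[R]_3 := mulmx M @^-1` (mulmx (g i) @` @domD R).

Lemma family_inG i : inG (g i). Proof. by case: tg. Qed.

Lemma pieceP i v : piece i v <-> domD (invmx (g i) *m (M *m v)).
Proof.
have u := inG_unit (family_inG i).
by split=> [[p dp <-]|h]; [rewrite mulKmx|exists (invmx (g i) *m (M *m v));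
    rewrite ?mulKVmx].
Qed.

Lemma phiK i v : phi M (g i) *m (invmx (g i) *m (M *m v)) = v.
Proof.
have u := inG_unit (family_inG i); have uM := ATM_unit AM.
by rewrite /phi -mulmxA mulKVmx ?mulKmx.
Qed.

Lemma phiVK i v : invmx (g i) *m (M *m (phi M (g i) *m v)) = v.
Proof. by rewrite mulmx_phi // mulKmx //; exact/inG_unit/family_inG. Qed.

Lemma piece_domD i : piece i `<=` @domD R.
Proof.
move=> v /pieceP h; rewrite -(phiK i v); apply: tile_sub => //.
  exact: family_inG.
by case: tg.
Qed.

Lemma closed_piece i : closed (piece i).
Proof.
rewrite (_ : piece i = [set v | @domD R (invmx (g i) *m M *m v)]).
  by apply: closed_preimage_mulmx; exact: closed_domD.
by apply/seteqP; split=> v; rewrite /= -mulmxA => /pieceP.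
Qed.

(** M sends this point to [g i *m p], whose representative in D is [p]. *)
Lemma f_phi i p : domD p -> f (phi M (g i) *m p) = p.
Proof.
move=> dp; have Gg := family_inG i.
have dphi : domD (phi M (g i) *m p) by apply: tile_sub => //; case: tg.
have [df [h Gh E]] := hf dphi; rewrite mulmx_phi // mulmxA in E.
exact: (domD_unique (inG_mul Gh Gg) dp df E).
Qed.

(** An interior point [w] of D is phi M (h^-1) (f w) for some [h] in G, and [tile_out] places h^-1
    in the family. A boundary point is a limit of interior ones along the segment to the center, and
    a finite union of closed pieces is closed. *)
Lemma piece_cover : \bigcup_i piece i = @domD R.
Proof.
apply/seteqP; split=> [v [i _ /piece_domD]//|v dv].
have cl : closed (\bigcup_i piece i).
  by apply: closed_bigcup => [|i _]; [exact: finite_finset|exact: closed_piece].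
have int_cover w : intD w -> (\bigcup_i piece i) w.
  move=> iw; have [dfw [h Gh E]] := hf (intD_domD iw).
  have Ew : w = phi M (invmx h) *m f w.
    by rewrite E /phi -mulmxA mulKmx ?inG_unit // mulKmx // ATM_unit.
  have [_ _ _ /(_ (invmx h) (inG_inv Gh))[]] := tg.
    by apply: tile_out (AM) (inG_inv Gh) dfw _; rewrite -Ew.
  move=> i hi; exists i => //; exists (f w) => //.
  by rewrite -hi E mulKmx // inG_unit.
apply: contrapT => nv.
have : nbhs v (~` \bigcup_i piece i) by apply: open_nbhs_nbhs; split=> //;
    exact: closed_openC.
move=> /(@near_conv _ _ (center R))[e e0 /(_ (Num.min (e / 2) (1 / 2)))].
set s := Num.min _ _.
have s0 : 0 < s by rewrite lt_min; apply/andP; split; lra.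
have se : s < e by rewrite gt_min; apply/orP; left; lra.
have s1 : s < 1 by rewrite gt_min; apply/orP; right; lra.
rewrite (ltW s0) se => /(_ isT); apply; apply: int_cover.
have -> : (1 - s) *: v + s *: center R = (1 - (1 - s)) *: center R + (1 - s) *: v.
  by rewrite addrC; congr (_ *: _ + _); ring.
by apply: intD_conv => //; [lra|exact: center_intD].
Qed.

Lemma intD_conv_center s p : domD p -> 0 < s <= 1 ->
  intD ((1 - s) *: p + s *: center R).
Proof.
move=> dp hs.
have -> : (1 - s) *: p + s *: center R = (1 - (1 - s)) *: center R + (1 - s) *: p.
  by rewrite addrC; congr (_ *: _ + _); ring.
by apply: intD_conv => //; [lra|exact: center_intD].
Qed.

(** From a common point, a small move towards the image of the center in piece [i] reaches the
    interior of that piece without leaving piece [j]; then [tile_key] applies. *)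
Lemma pieces_disjoint : disjoint_interiors (@domD R) piece.
Proof.
move=> i j ij; apply/seteqP; split=> // v [vi vj].
have Gi := family_inG i.
have [_ _ /(_ i) ci _] := tg.
have cD : domD (phi M (g i) *m center R) by exact: intD_domD.
have dv : domD v by case: vi.
have [|e e0 He] := @relint_conv _ _ _ v (phi M (g i) *m center R) vj.
  by move=> s hs; apply: domD_conv => //; lra.
have [p dp Ep] := relint_sub vi.
set s := Num.min (e / 2) 1.
have s0 : 0 < s by rewrite lt_min; apply/andP; split; lra.
have se : s < e by rewrite gt_min; apply/orP; left; lra.
have s1 : s <= 1 by rewrite ge_min; apply/orP; right.
have := He s; rewrite (ltW s0) se => /(_ isT)[q dq].
rewrite mulmxDr -!scalemxAr -Ep mulmx_phi // !scalemxAr -mulmxDr => E.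
case: ij; have [_ ginj _ _] := tg; apply: ginj.
apply: (tile_key Gi (family_inG j) _ dq (esym E)).
by apply: intD_conv_center => //; rewrite s0.
Qed.

Lemma image_chambers : \bigcup_i mulmx (g i) @` @domD R = mulmx M @` @domD R.
Proof.
rewrite -[X in _ = _ @` X]piece_cover; apply/seteqP;
    split=> [_ [i _ [p dp <-]]|_ [v [i _ [p dp Ep]] <-]].
  exists (phi M (g i) *m p); last exact: mulmx_phi.
  by exists i => //; exists p => //; rewrite mulmx_phi.
by exists i => //; exists p.
Qed.

(** Disjointness is argued as for the pieces, with interiors taken in the whole plane instead of
    D. *)
Lemma chambers_tile : tiles (fun i => mulmx (g i) @` @domD R) (mulmx M @` @domD R).
Proof.
split; first exact: image_chambers.
move=> i j ij; apply/seteqP; split=> // v [vi vj].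
have Gi := family_inG i.
have cA : planeA (g i *m center R).
  by apply: planeA_affmx; [exact: inG_aff|case: (center_intD R)].
have hv : planeA v by case: vi.
have [|e e0 He] := @relint_conv _ _ _ v (g i *m center R) vj.
  by move=> s hs; apply: planeA_conv.
have [p dp Ep] := relint_sub vi.
set s := Num.min (e / 2) 1.
have s0 : 0 < s by rewrite lt_min; apply/andP; split; lra.
have se : s < e by rewrite gt_min; apply/orP; left; lra.
have s1 : s <= 1 by rewrite ge_min; apply/orP; right.
have := He s; rewrite (ltW s0) se => /(_ isT)[q dq].
rewrite -Ep !scalemxAr -mulmxDr => E.
case: ij; have [_ ginj _ _] := tg; apply: ginj.
apply: (tile_key Gi (family_inG j) _ dq (esym E)).
by apply: intD_conv_center => //; rewrite s0.
Qed.

Lemma f_piece i v : piece i v -> f v = invmx (g i) *m (M *m v).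
Proof. by move=> /pieceP h; rewrite -{1}(phiK i v) f_phi. Qed.

Lemma pieces_markov : markov_partition f piece.
Proof.
split.
- exact: closed_piece.
- exact: piece_cover.
- exact: pieces_disjoint.
- move=> i v w /set_mem pv /set_mem pw; rewrite (f_piece pv) (f_piece pw) => E.
  by rewrite -(phiK i v) E phiK.
(* Every branch is full: each piece is mapped onto the whole of D. *)
- move=> i; exists setT; rewrite piece_cover.
  apply/seteqP; split=> [_ [v pv <-]|p dp].
    by rewrite (f_piece pv); exact/pieceP.
  exists (phi M (g i) *m p); last exact: f_phi.
  by apply/pieceP; rewrite phiVK.
Qed.

End Family.

End Tiles.

(** * Area under affine maps *)

Section ImageMeasure.
Context d1 d2 (T1 : measurableType d1) (T2 : measurableType d2) (R : realType).
Variables (m : {measure set T1 -> \bar R}) (f : T1 -> T2).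
Hypothesis mf : measurable_fun [set: T1] f.

(* unlike [pushforward], this records the measurability of f in the term *)
Definition image_measure of measurable_fun [set: T1] f := pushforward m f.
Let im := image_measure mf.

Let im0 : im set0 = 0%E. Proof. by rewrite /im /image_measure /pushforward
    preimage_set0 measure0. Qed.

Let im_ge0 A : (0 <= im A)%E.
Proof. exact: measure_ge0. Qed.

Let im_sigma_additive : semi_sigma_additive im.
Proof. exact: measure_semi_sigma_additive. Qed.

HB.instance Definition _ := isMeasure.Build _ _ _ (image_measure mf) im0 im_ge0
    im_sigma_additive.

End ImageMeasure.

Section AffineMeasure.
Variable R : realType.
Notation leb := (@lebesgue_measure R).
Notation plane := (measurableTypeR R * measurableTypeR R)%type.
Notation leb2 := (leb \x leb)%E.

Lemma measurable_affine1 (s b : R) :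
  measurable_fun [set: measurableTypeR R] ((fun y => s * y + b) : measurableTypeR R
      -> measurableTypeR R).
Proof.
by apply: measurable_funD; [exact: measurable_funM|].
Qed.

(** By uniqueness of Lebesgue measure: [|s|] times the image measure has the same values on
    half-open intervals. *)
Lemma lebesgue_measure_affine (s b : R) (A : set (measurableTypeR R)) :
  s != 0 -> measurable A ->
  leb ((fun y => s * y + b) @^-1` A) = ((`|s|^-1)%:E * leb A)%E.
Proof.
move=> s0 mA; have s0' : 0 < `|s| by rewrite normr_gt0.
pose m := mscale (NngNum (ltW s0')) (image_measure leb (measurable_affine1 s b)).
suff -> : leb A = m A.
  by rewrite /m /= /mscale /= /image_measure /pushforward muleA -EFinM mulVf ?mul1e
      ?gt_eqF.
apply: lebesgue_measure_unique mA => _ [[x y] _ <-].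
rewrite /m /= /mscale /image_measure /pushforward /= lebesgue_measure_itv /= lte_fin.
have [sp|sn] : 0 < s \/ s < 0 by apply/orP; rewrite orbC -neq_lt.
  rewrite (_ : _ @^-1` _ = `](x - b) / s, (y - b) / s]%classic); last first.
    apply/seteqP; split=> z /=; rewrite !in_itv /= ltr_pdivrMr // ler_pdivlMr //; lra.
  rewrite lebesgue_measure_itv /= lte_fin ltr_pM2r ?invr_gt0 // ltrD2r.
  case: ifPn => _; last by rewrite mule0.
  by rewrite -!EFinB -EFinM (gtr0_norm sp); congr EFin; field.
(* A negative slope exchanges the open and the closed end. *)
rewrite (_ : _ @^-1` _ = `[(y - b) / s, (x - b) / s[%classic); last first.
  apply/seteqP; split=> z /=; rewrite !in_itv /= ltr_ndivlMr // ler_ndivrMr //; lra.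
rewrite lebesgue_measure_itv /= lte_fin ltr_nM2r ?invr_lt0 // ltrD2r.
case: ifPn => _; last by rewrite mule0.
by rewrite -!EFinB -EFinM (ltr0_norm sn); congr EFin; field.
Qed.

Definition aff2 (p q r s e f : R) (z : plane) : plane :=
  (p * z.1 + q * z.2 + e, r * z.1 + s * z.2 + f).

Lemma measurable_aff2 p q r s e f : measurable_fun setT (aff2 p q r s e f).
Proof.
apply: measurable_fun_pair.
- by apply: measurable_funD => //; apply: measurable_funD; apply: measurable_funM.
- by apply: measurable_funD => //; apply: measurable_funD; apply: measurable_funM.
Qed.

Lemma measurable_preimage_aff2 p q r s e f (E : set plane) : measurable E ->
  measurable (aff2 p q r s e f @^-1` E).
Proof. by move=> mE; rewrite -[_ @^-1` _]setTI; exact: measurable_aff2. Qed.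

Lemma leb2_shear (r s f : R) (E : set plane) : s != 0 -> measurable E ->
  leb2 (aff2 1 0 r s 0 f @^-1` E) = ((`|s|^-1)%:E * leb2 E)%E.
Proof.
move=> s0 mE; rewrite /product_measure1 -ge0_integralZl //;
    last exact: measurable_fun_xsection.
apply: eq_integral => x _ /=.
rewrite -(@lebesgue_measure_affine s (r * x + f)) //; last exact: measurable_xsection.
have e y : aff2 1 0 r s 0 f (x, y) = (x, s * y + (r * x + f)).
  by rewrite /aff2 /=; congr (_, _); ring.
by congr lebesgue_measure; apply/seteqP; split=> y; rewrite !xsectionE /= e.
Qed.

Lemma leb2_swap (E : set plane) : measurable E -> leb2 (swap_pair @^-1` E) = leb2 E.
Proof.
move=> mE; have ms : measurable_fun setT (@swap_pair (measurableTypeR R)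
    (measurableTypeR R)).
  exact: measurable_fun_pair.
rewrite [RHS](@product_measure_unique _ _ _ _ R leb leb (image_measure leb2 ms)) //.
move=> A B mA mB; rewrite /= /image_measure /pushforward /=.
rewrite (_ : swap_pair @^-1` _ = B `*` A);
    first by rewrite product_measure1E // muleC.
by apply/seteqP; split=> -[x y] /= [].
Qed.

Lemma leb2_aff2 (p q r s e f : R) (E : set plane) : p * s - q * r != 0 ->
    measurable E ->
  leb2 (aff2 p q r s e f @^-1` E) = ((`|p * s - q * r|^-1)%:E * leb2 E)%E.
Proof.
(* If s = 0 then q is nonzero, and exchanging the two output coordinates puts q in its place. *)
wlog s0 : p q r s e f E / s != 0 => [hw d0 mE|].
  have [s0|] := eqVneq s 0; last by move=> ?; exact: hw.
  have q0 : q != 0 by apply: contra_neq d0 => ->; rewrite s0; ring.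
  rewrite -(leb2_swap mE).
  have := hw r s p q f e (swap_pair @^-1` E) q0; rewrite distrC.
  rewrite mulrC [s * p]mulrC => <- //; first by rewrite -opprB oppr_eq0.
  by rewrite -[_ @^-1` _]setTI; exact: measurable_fun_pair.
move=> d0 mE; set d := p * s - q * r in d0 *.
(* Factorization into two shears: first v = r x + s y + f replaces y, then the other coordinate is
   (q / s) v + (d / s) x + e - q f / s. *)
pose E1 : set plane := aff2 1 0 (q / s) (d / s) 0 (e - q * f / s) @^-1` (swap_pair
    @^-1` E).
have ms : measurable (swap_pair @^-1` E : set plane).
  by rewrite -[_ @^-1` _]setTI; exact: measurable_fun_pair.
have mE1 : measurable E1 by exact: measurable_preimage_aff2.
have ms1 : measurable (swap_pair @^-1` E1 : set plane).
  by rewrite -[_ @^-1` _]setTI; exact: measurable_fun_pair.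
have -> : aff2 p q r s e f @^-1` E = aff2 1 0 r s 0 f @^-1` (swap_pair @^-1` E1).
  apply/seteqP; split=> -[x y]; rewrite /E1 /= /aff2 /swap_pair /=;
  congr (E (_, _)); rewrite /d; field; done.
rewrite leb2_shear // leb2_swap // leb2_shear //; last by rewrite mulf_neq0 ?invr_eq0.
rewrite leb2_swap // muleA -EFinM; congr (_%:E * _)%E.
by rewrite -invfM -normrM; congr (`|_|^-1); field.
Qed.

End AffineMeasure.

(** * Borel sets and areas in the chart of the plane *)

Section Area.
Variable R : realType.
Notation leb := (@lebesgue_measure R).
Notation plane := (measurableTypeR R * measurableTypeR R)%type.
Notation leb2 := (leb \x leb)%E.
Implicit Types (v w : 'cV[R]_3) (N : 'M[R]_3).

Definition borelT := g_sigma_algebraType (@open 'cV[R]_3).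

Lemma borelE (E : set 'cV[R]_3) : borel E <-> measurable (E : set borelT).
Proof. by []. Qed.

Lemma borel_open (E : set 'cV[R]_3) : open E -> borel E.
Proof. by move=> oE; apply: sub_sigma_algebra. Qed.

Lemma borel_closed (E : set 'cV[R]_3) : closed E -> borel E.
Proof.
move=> /closed_openC/borel_open bC; apply/borelE; rewrite -(setCK E).
exact: measurableC.
Qed.

Lemma borel_mulmx N (E : set 'cV[R]_3) : borel E -> borel [set v | E (N *m v)].
Proof.
move=> bE; suff mN : measurable_fun [set: borelT] (mulmx N : borelT -> borelT).
  by have := mN measurableT E bE; rewrite setTI.
apply: (@measurability _ _ borelT borelT setT (mulmx N) (@open 'cV[R]_3) erefl).
move=> _ [U oU <-]; rewrite setTI; apply: borel_open.
by apply: open_comp oU => v _; exact: continuous_mulmx.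
Qed.

Lemma chart0 (z : plane) : chart z 0 0 = z.1. Proof. by rewrite mxE. Qed.
Lemma chart1 (z : plane) : chart z 1 0 = z.2. Proof. by rewrite mxE. Qed.
Lemma chart2 (z : plane) : chart z 2 0 = 1 - z.1 - z.2. Proof. by rewrite mxE. Qed.
Definition chartE := (chart0, chart1, chart2).

Lemma chart_planeA z : planeA (chart z : 'cV[R]_3).
Proof. by rewrite /planeA /= !chartE; ring. Qed.

Lemma measurable_coord_chart i : measurable_fun [set: plane] (fun z : plane =>
    chart z i 0).
Proof.
move: i; elim/forall_ord3.
- by rewrite (_ : (fun _ => _) = fst) //; apply/funext => z; rewrite chartE.
- by rewrite (_ : (fun _ => _) = snd) //; apply/funext => z; rewrite chartE.
- rewrite (_ : (fun _ => _) = (fun z : plane => 1 - z.1 - z.2)).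
    by apply: measurable_funB => //; apply: measurable_funB.
  by apply/funext => z; rewrite chartE.
Qed.

(** Cubes with rational center and half-width: a countable base of the topology, whose members are
    tested coordinate by coordinate. *)
Definition box (k : (rat * rat * rat) * rat) : set 'cV[R]_3 :=
  [set v | forall i : 'I_3, let q := nth 0 [:: k.1.1.1; k.1.1.2; k.1.2] i in
     ratr (q - k.2) < v i 0 < ratr (q + k.2)].

Lemma open_boxes (U : set 'cV[R]_3) : open U ->
  U = \bigcup_(k in [set k | box k `<=` U]) box k.
Proof.
move=> oU; apply/seteqP; split=> [v Uv|v [k /= kU kv]]; last exact: kU.
have /nbhs_ballP[e e0 He] : nbhs v U by exact: open_nbhs_nbhs.
have e20 : 0 < e / 2 by rewrite divr_gt0 //.
have [r] := rat_in_itvoo e20; rewrite in_itv /= => /andP[r0 re].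
have Q i : exists q : rat, v i 0 - ratr r < (ratr q : R) < v i 0 + ratr r.
  have [|q] := @rat_in_itvoo R (v i 0 - ratr r) (v i 0 + ratr r); first by lra.
  by rewrite in_itv /= => hq; exists q.
have [q0 h0] := Q 0; have [q1 h1] := Q 1; have [q2 h2] := Q 2.
exists ((q0, q1, q2), r) => /=.
  move=> w hw; apply: He; split; first exact: e0.
  move=> i j; rewrite ord1 /ball /= ltr_norml.
  have := hw i; move: i {hw j}; elim/forall_ord3; rewrite /= rmorphB rmorphD /=; lra.
by elim/forall_ord3; rewrite /= rmorphB rmorphD /=; lra.
Qed.

Lemma measurable_chart : measurable_fun [set: plane] (@chart R : plane -> borelT).
Proof.
apply: (@measurability _ _ plane borelT setT (@chart R) (@open 'cV[R]_3) erefl).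
move=> _ [U oU <-]; rewrite setTI (open_boxes oU) preimage_bigcup.
rewrite bigcup_mkcond; apply: countable_bigcupT_measurable => // k.
case: ifP => // _.
rewrite (_ : _ @^-1` _ = \bigcap_(i in [set: 'I_3])
   (fun z : plane => chart z i 0) @^-1` `]ratr (nth 0 [:: k.1.1.1; k.1.1.2;
       k.1.2] i - k.2),
     ratr (nth 0 [:: k.1.1.1; k.1.1.2; k.1.2] i + k.2)[%classic); last first.
  apply/seteqP; split=> z /=; first by move=> h i _; rewrite /= in_itv /=; exact: h.
  by move=> h i; have := h i I; rewrite /= in_itv.
apply: fin_bigcap_measurable => // i _.
by rewrite -[_ @^-1` _]setTI; apply: measurable_coord_chart.
Qed.

Lemma borel_measurable_chart (E : set 'cV[R]_3) : borel E ->
  measurable (@chart R @^-1` E : set plane).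
Proof.
by move=> bE; rewrite -[_ @^-1` _]setTI; exact: measurable_chart.
Qed.

(** The area read in the chart; the factor sqrt 3 of [area] cancels in [muD]. *)
Definition area2 (S : set 'cV[R]_3) : \bar R := leb2 (@chart R @^-1` S).

(** The right-hand side is the determinant of the linear part of N read in the chart. *)
Lemma affmx_det N : affmx N -> \det N =
  (N 0 0 - N 0 2) * (N 1 1 - N 1 2) - (N 0 1 - N 0 2) * (N 1 0 - N 1 2).
Proof.
move=> hN; rewrite det3.
have m0 : N 2 0 = 1 - N 0 0 - N 1 0 by have := hN 0; lra.
have m1 : N 2 1 = 1 - N 0 1 - N 1 1 by have := hN 1; lra.
have m2 : N 2 2 = 1 - N 0 2 - N 1 2 by have := hN 2; lra.
rewrite m0 m1 m2; ring.
Qed.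

Lemma mulmx_chart N (z : plane) : affmx N -> N *m chart z =
  chart (aff2 (N 0 0 - N 0 2) (N 0 1 - N 0 2) (N 1 0 - N 1 2) (N 1 1 - N 1 2)
           (N 0 2) (N 1 2) z).
Proof.
move=> hN.
have m0 : N 2 0 = 1 - N 0 0 - N 1 0 by have := hN 0; lra.
have m1 : N 2 1 = 1 - N 0 1 - N 1 1 by have := hN 1; lra.
have m2 : N 2 2 = 1 - N 0 2 - N 1 2 by have := hN 2; lra.
by apply: cV3P; rewrite mulmx_cV3 !chartE /aff2 /= ?m0 ?m1 ?m2; ring.
Qed.

Lemma area2_preimage N (E : set 'cV[R]_3) : affmx N -> N \in unitmx -> borel E ->
  area2 [set v | E (N *m v)] = ((`|\det N|^-1)%:E * area2 E)%E.
Proof.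
move=> hN uN bE; have dN : \det N != 0 by rewrite -unitfE -unitmxE.
rewrite /area2 affmx_det // -(@leb2_aff2 _ _ _ _ _ (N 0 2) (N 1 2)).
- by congr (leb2 _); apply/seteqP; split=> z; rewrite /= mulmx_chart.
- by rewrite -affmx_det.
- exact: borel_measurable_chart.
Qed.

Lemma leb2_line (a b : R) : leb2 [set z : plane | z.2 = a * z.1 + b] = 0%E.
Proof.
rewrite (_ : [set z | _] = aff2 1 0 (- a) 1 0 (- b) @^-1` (setT `*` [set 0]));
    last first.
  by apply/seteqP; split=> -[x y] /=; rewrite /aff2 /=; [move=> ->; split=> //;
      ring|case=> _; lra].
have m0 : measurable ([set: measurableTypeR R] `*` [set 0 : measurableTypeR R]).
  by apply: measurableX.
rewrite leb2_aff2 //; last by rewrite mul1r mul0r subr0 oner_neq0.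
by rewrite product_measure1E //= lebesgue_measure_set1 !mule0.
Qed.

Lemma borel_domD : borel (@domD R).
Proof. exact: (borel_closed (@closed_domD R)). Qed.

Lemma borelI (E F : set 'cV[R]_3) : borel E -> borel F -> borel (E `&` F).
Proof. by move=> bE bF; apply/borelE; exact: measurableI. Qed.

Lemma borel_intD : borel (@intD R).
Proof.
have cc i : continuous (fun v : 'cV[R]_3 => v i 0) by exact: coord_continuous.
have -> : @intD R = @domD R `&` ([set v | 0 < v 2 0] `&`
   ([set v | 0 < v 1 0 - v 2 0] `&` [set v | 0 < v 0 0 - v 1 0])).
  apply/seteqP; split=> v.
    by move=> iv; have [_ h] := iv; split; [exact: intD_domD|do !split; rewrite /=;
        lra].
  by move=> [[hv _] [/= ? [/= ? /= ?]]]; split=> //; lra.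
apply: borelI; first exact: borel_domD.
have O (f : 'cV[R]_3 -> R) : continuous f -> borel [set v | 0 < f v].
  move=> cf; apply: borel_open; apply: (@open_comp _ _ f [set x | 0 < x]);
      last exact: open_gt.
  by move=> v _; exact: cf.
apply: borelI; [|apply: borelI]; apply: O => // v.
- exact: (continuousB (cc 1 v) (cc 2 v)).
- exact: (continuousB (cc 0 v) (cc 1 v)).
Qed.

Lemma area2_domD_intD : area2 (@domD R `\` @intD R) = 0%E.
Proof.
apply/eqP; rewrite -measure_le0.
pose L (a b : R) : set plane := [set z | z.2 = a * z.1 + b].
have mL a b : measurable (L a b).
  rewrite (_ : L a b = (fun z : plane => z.2 - (a * z.1 + b)) @^-1` [set 0]).
    rewrite -[_ @^-1` _]setTI; apply: measurable_funB => //.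
    by apply: measurable_funD => //; apply: measurable_funM.
  by apply/seteqP; split=> z; rewrite /L /=; lra.
pose Z := L 1 0 `|` (L (- (1 / 2)) (1 / 2) `|` L (-1) 1).
(* In the chart, [Z] is the union of the lines x = y, y = z and z = 0 that carry the sides. *)
have : (leb2 Z <= 0)%E.
  have z0 a b : leb2 (L a b) = 0%E by exact: leb2_line.
  have z a b a' b' : leb2 (L a b `|` L a' b') = 0%E.
    by rewrite measureU0; [exact: z0|exact: mL|exact: mL|exact: z0].
  rewrite measureU0; [by rewrite [X in (X <= _)%E]z0|exact: mL|exact:
      measurableU|exact: z].
apply: le_trans; apply: le_measure; rewrite ?inE.
- rewrite setDE preimage_setI; apply: measurableI.
    exact: (borel_measurable_chart borel_domD).
  rewrite -preimage_setC; apply: measurableC.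
  exact: (borel_measurable_chart borel_intD).
- by apply: measurableU => //; exact: measurableU.
move=> [x y] [/= [hz hd] ni]; rewrite !chartE /= in hd.
have [e1|n1] := eqVneq y x; first by left; rewrite /L /=; lra.
have [e2|n2] := eqVneq y (1 - x - y); first by right; left; rewrite /L /=; lra.
have [e3|n3] := eqVneq (1 - x - y) 0; first by right; right; rewrite /L /=; lra.
exfalso; apply: ni; split; first exact: chart_planeA.
rewrite !chartE /= -!andbA; apply/and3P; split.
- by rewrite lt_neqAle eq_sym n3; lra.
- by rewrite lt_neqAle eq_sym n2; lra.
- by rewrite lt_neqAle n1; lra.
Qed.

Lemma area2_intD : area2 (@intD R) = area2 (@domD R).
Proof.
have mi := borel_measurable_chart borel_intD.
have md := borel_measurable_chart borel_domD.
have -> : area2 (@domD R) = leb2 (@chart R @^-1` (@intD R) `|` @chart R @^-1`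
    (@domD R `\` @intD R)).
  congr (leb2 _); rewrite -preimage_setU; congr (_ @^-1` _).
  by apply/esym/setDUK => v; exact: intD_domD.
rewrite measureU0 //; first by rewrite setDE preimage_setI -preimage_setC -setDE;
    exact: measurableD.
exact: area2_domD_intD.
Qed.

Lemma area2_domD_lty : (area2 (@domD R) < +oo)%E.
Proof.
have m01 : measurable (`[0, 1] : set (measurableTypeR R)) by exact: measurable_itv.
apply: (@le_lt_trans _ _ (leb2 (`[0, 1] `*` `[0, 1]))).
  apply: le_measure; rewrite ?inE.
  - exact: (borel_measurable_chart borel_domD).
  - exact: measurableX.
  - by move=> [x y] [/= _]; rewrite !chartE /= => h; split; rewrite /= in_itv /=; lra.
by rewrite product_measure1E //= lebesgue_measure_itv /= lte_fin ltr01 -EFinB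
    -EFinM ltry.
Qed.

Lemma area2_domD_gt0 : (0 < area2 (@domD R))%E.
Proof.
(* A square of half-width 1/36 around the centroid, whose chart coordinates are 22/36 and 10/36. *)
have m1 : measurable (`[21 / 36, 23 / 36] : set (measurableTypeR R)) by exact:
    measurable_itv.
have m2 : measurable (`[9 / 36, 11 / 36] : set (measurableTypeR R)) by exact:
    measurable_itv.
apply: (@lt_le_trans _ _ (leb2 (`[21 / 36, 23 / 36] `*` `[9 / 36, 11 / 36]))).
  rewrite product_measure1E //= !lebesgue_measure_itv /= !lte_fin.
  rewrite !ifT; [|lra|lra]; rewrite -!EFinB -EFinM lte_fin; lra.
apply: le_measure; rewrite ?inE.
- exact: measurableX.
- exact: (borel_measurable_chart borel_domD).
- move=> [x y] [/=]; rewrite !in_itv /= => h1 h2; split; first exact: chart_planeA.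
  by rewrite !chartE /=; lra.
Qed.

End Area.

(** * The number of chambers *)

Section Counting.
Variable R : realType.
Implicit Types (v w p : 'cV[R]_3) (M N g h : 'M[R]_3).
Notation leb := (@lebesgue_measure R).
Notation plane := (measurableTypeR R * measurableTypeR R)%type.
Notation leb2 := (leb \x leb)%E.

Lemma image_mulmx N (S : set 'cV[R]_3) : N \in unitmx ->
  mulmx N @` S = [set v | S (invmx N *m v)].
Proof.
move=> uN; apply/seteqP; split=> [_ [v Sv <-]|v Sv]; first by rewrite /= mulKmx.
by exists (invmx N *m v) => //; rewrite mulKVmx.
Qed.

Lemma borel_image N (S : set 'cV[R]_3) : N \in unitmx -> borel S ->
  borel (mulmx N @` S).
Proof. by move=> uN bS; rewrite image_mulmx //; exact: borel_mulmx. Qed.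

Lemma area2_image N (S : set 'cV[R]_3) : affmx N -> N \in unitmx -> borel S ->
  area2 (mulmx N @` S) = (`|\det N|%:E * area2 S)%E.
Proof.
move=> hN uN bS; rewrite image_mulmx // area2_preimage ?unitmx_inv //.
  by rewrite det_inv normfV invrK.
exact: affmx_inv.
Qed.

Lemma area2_chamber g (S : set 'cV[R]_3) : inG g -> borel S ->
  area2 (mulmx g @` S) = area2 S.
Proof.
move=> Gg bS; rewrite area2_image ?inG_det ?mul1e //; first exact: inG_aff.
exact: inG_unit.
Qed.

Lemma area2_domD_fin : area2 (@domD R) \is a fin_num.
Proof. by rewrite gt0_fin_numE ?area2_domD_lty // area2_domD_gt0. Qed.

(** The open chambers are disjoint subsets of M D, whose area is |det M| times that of D. No
    covering is assumed, because the same bound yields the finiteness of the set of chambers in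
    [tile_family_exists]. *)
Lemma card_tiles_le M n (g : 'I_n -> 'M[R]_3) : ATM M ->
  (forall i, inG (g i)) -> injective g ->
  (forall i, intD (phi M (g i) *m center R)) -> n%:R <= `|\det M|.
Proof.
move=> AM Gg ginj cg.
pose F i : set plane := @chart R @^-1` (mulmx (g i) @` @intD R).
have mF i : measurable (F i).
  apply: borel_measurable_chart; apply: borel_image (@borel_intD R).
  exact: inG_unit.
have tF : trivIset setT F.
  apply/trivIsetP => i j _ _ ij; apply/seteqP; split=> // z [[p ip Ep] [q iq Eq]].
  case/eqP: ij; apply: ginj; apply: (tile_key (Gg i) (Gg j) ip (intD_domD iq)).
  by rewrite Ep Eq.
have mM : measurable (@chart R @^-1` (mulmx M @` @domD R) : set plane).
  apply: borel_measurable_chart; apply: borel_image (@borel_domD R).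
  exact: ATM_unit.
have : (leb2 (\big[setU/set0]_(i < n) F i) <= leb2 (@chart R @^-1` (mulmx M @`
    @domD R)))%E.
  apply: le_measure; rewrite ?inE //; first exact: bigsetU_measurable.
  rewrite -bigcup_seq => z [i _ [p ip Ep]].
  exists (phi M (g i) *m p); first exact/tile_sub/intD_domD.
  by rewrite mulmx_phi.
rewrite measure_bigsetU_ord //.
rewrite [X in (_ <= X)%E](area2_image (ATM_aff AM) (ATM_unit AM) (@borel_domD R)).
rewrite (eq_bigr (fun=> area2 (@domD R))); last first.
  by move=> i _; rewrite -area2_intD; exact: (area2_chamber (Gg i) (@borel_intD R)).
rewrite -(fineK area2_domD_fin) sumEFin -EFinM lee_fin sumr_const card_ord -[X in X
    <= _ -> _]mulr_natl.
by rewrite ler_pM2r // fine_gt0 // area2_domD_gt0 area2_domD_lty.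
Qed.

Lemma tile_family_exists M : ATM M ->
  exists n (g : 'I_n -> 'M[R]_3), tile_family M g.
Proof.
move=> AM; pose S : set 'M[R]_3 := [set g | inG g /\ intD (phi M g *m center R)].
have fS : finite_set S.
  apply: contrapT => /(infinite_set_fset (Num.truncn `|\det M|).+1)[B BS cB].
  pose s := finmap.enum_fset B.
  have cB' : (size s)%:R <= `|\det M|.
    pose g (i : 'I_(size s)) := nth 0 s i.
    have gB i : S (g i) by apply: BS; rewrite /= mem_nth.
    apply: (@card_tiles_le M _ g) => // [i|i j|i]; try by case: (gB i).
    by move/eqP; rewrite nth_uniq ?finmap.fset_uniq // => /eqP/val_inj.
  have := truncnS_gt `|\det M|; rewrite ltNge => /negP; apply.
  by apply: le_trans cB'; rewrite ler_nat.
have [s us sS] : exists2 s : seq 'M[R]_3, uniq s & forall g, S g <-> g \in s.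
  have [s Es] := (finite_seqP S).1 fS; exists (undup s); first exact: undup_uniq.
  by move=> g; rewrite mem_undup Es.
exists (size s), (fun i => nth 0 s i); split.
- by move=> i; have [] := (sS (nth 0 s i)).2 (mem_nth _ (ltn_ord i)).
- by move=> i j /eqP; rewrite nth_uniq // => /eqP/val_inj.
- by move=> i; have [] := (sS (nth 0 s i)).2 (mem_nth _ (ltn_ord i)).
- move=> h Gh ch; have hs : h \in s by exact/sS.
  by rewrite -index_mem in hs; exists (Ordinal hs); rewrite nth_index // -index_mem.
Qed.

Lemma card_tiles M n (g : 'I_n -> 'M[R]_3) f : ATM M ->
  linear_triangle_map M f -> tile_family M g -> n%:R = `|\det M|.
Proof.
move=> AM hf tg; have [Gg ginj cg _] := tg.
apply: le_anti; rewrite (@card_tiles_le _ _ g) //=.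
(* Subadditivity is stated for sequences; the family is extended by the empty set. *)
pose F k : set plane := if insub k is Some i then
  @chart R @^-1` (mulmx (g i) @` @domD R) else set0.
have mF k : measurable (F k).
  rewrite /F; case: insubP => // i _ _; apply: borel_measurable_chart.
  apply: borel_image (@borel_domD R); exact: inG_unit.
have mM : measurable (@chart R @^-1` (mulmx M @` @domD R) : set plane).
  apply: borel_measurable_chart; apply: borel_image (@borel_domD R).
  exact: ATM_unit.
have : (leb2 (@chart R @^-1` (mulmx M @` @domD R)) <= \sum_(k < n) leb2 (F k))%E.
  apply: content_subadditive => // z hz.
  have : (mulmx M @` @domD R) (chart z) by exact: hz.
  rewrite -(image_chambers AM hf tg) => -[i _ hi].
  rewrite -bigcup_mkord; exists (i : nat) => /=; first exact: ltn_ord.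
  by rewrite /F valK.
rewrite [X in (X <= _)%E](area2_image (ATM_aff AM) (ATM_unit AM) (@borel_domD R)).
rewrite (eq_bigr (fun=> area2 (@domD R))); last first.
  by move=> i _; rewrite /F valK; exact: (area2_chamber (Gg i) (@borel_domD R)).
rewrite -(fineK area2_domD_fin) sumEFin -EFinM lee_fin sumr_const card_ord -[X in _
    <= X -> _]mulr_natl.
by rewrite ler_pM2r // fine_gt0 // area2_domD_gt0 area2_domD_lty.
Qed.

End Counting.

(** * The one-sided Bernoulli shift *)

Section Cylinders.
Variable d : nat.
Implicit Types (w u v : seqspace d).

Definition cyl n u : set (seqspace d) := [set w | forall i, (i < n)%N -> w i = u i].

Lemma cyl0 u : cyl 0 u = setT.
Proof. by apply/seteqP; split. Qed.

Lemma open_cyl n u : open (cyl n u).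
Proof.
elim: n => [|n IH]; first by rewrite cyl0; exact: openT.
have -> : cyl n.+1 u = cyl n u `&` [set w | w n = u n].
  apply/seteqP; split=> [w h|w [h1 h2] i]; first by split=> [i hi|];
      apply: h => //; exact: ltnW.
  by rewrite ltnS leq_eqVlt => /predU1P[->//|/h1].
apply: openI => //.
apply: (@open_comp _ _ (fun w : seqspace d => w n) [set u n]); last first.
  exact: discrete_open.
by move=> w _; exact: (@proj_continuous nat (fun=> discrete_topology 'I_d.+1) n w).
Qed.

(** The filter generated by the cylinders around [u] converges to [u] in each coordinate, hence in
    the product topology. *)
Lemma nbhs_cyl u (U : set (seqspace d)) : nbhs u U -> exists n, cyl n u `<=` U.
Proof.
pose F : set_system (seqspace d) := filter_from setT (fun n => cyl n u).
have FF : Filter F.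
  apply: filter_from_filter; first by exists 0%N.
  move=> i j _ _; exists (maxn i j) => // w hw; split=> k hk; apply: hw.
    by rewrite leq_max hk.
  by rewrite leq_max hk orbT.
have Fu : F --> u.
  apply/(@pointwise_cvgP nat (discrete_topology 'I_d.+1)) => t A At.
  exists t.+1 => // w hw /=.
  by rewrite hw //; exact: nbhs_singleton At.
by move=> /Fu[n _ hn]; exists n.
Qed.

(** Finite words form a countable index set for cylinders; the padding by [ord0] lies beyond the
    coordinates that the cylinder of length [size s] constrains. *)
Definition word (s : seq 'I_d.+1) : seqspace d := nth ord0 s.

Lemma open_bigcup_cyl (U : set (seqspace d)) : open U ->
  U = \bigcup_(s in [set s | cyl (size s) (word s) `<=` U]) cyl (size s) (word s).
Proof.
move=> oU; apply/seteqP; split=> [w Uw|w [s /= sU sw]]; last exact: sU.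
have [n hn] := nbhs_cyl (open_nbhs_nbhs (conj oU Uw)).
have E : cyl (size (mkseq w n)) (word (mkseq w n)) = cyl n w.
  rewrite size_mkseq; apply/seteqP; split=> v hv i hi;
      rewrite hv // /word nth_mkseq //.
by exists (mkseq w n); rewrite /= E.
Qed.

(** The empty set is included for stability under intersection. *)
Definition cylinders : set (set (seqspace d)) :=
  [set C | C = set0 \/ exists n u, C = cyl n u].

Lemma cylinders_setI : setI_closed cylinders.
Proof.
move=> A B [->|[n [u ->]]]; first by left; rewrite set0I.
move=> [->|[m [v ->]]]; first by left; rewrite setI0.
wlog nm : n m u v / (n <= m)%N.
  by move=> hw; case: (leqP n m) => [/hw//|/ltnW/hw]; rewrite setIC; exact.
have [h|h] := pselect (forall i, (i < n)%N -> v i = u i).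
  right; exists m, v; apply/seteqP; split=> [w []//|w hw]; split=> // i hi.
  by rewrite hw ?h //; exact: leq_trans nm.
left; apply/seteqP; split=> // w [h1 h2]; apply: h => i hi.
by rewrite -h1 // h2 //; exact: leq_trans nm.
Qed.

Lemma seqborel_cylinders : @measurable _ (seqborel d) = <<s cylinders >>.
Proof.
apply/seteqP; split; last first.
  apply: smallest_sub; first exact: smallest_sigma_algebra.
  move=> _ [->|[n [u ->]]]; first exact: (@measurable0 _ (seqborel d)).
  by apply: sub_sigma_algebra; exact: open_cyl.
apply: smallest_sub; first exact: smallest_sigma_algebra.
move=> U oU; rewrite (open_bigcup_cyl oU) bigcup_mkcond.
apply: (@countable_bigcupT_measurable _ (g_sigma_algebraType cylinders)) => //.
move=> s; case: ifP => _; last exact: measurable0.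
by apply: sub_sigma_algebra; right; exists (size s), (word s).
Qed.

Lemma measurable_cyl n u : measurable (cyl n u : set (seqborel d)).
Proof. by rewrite seqborel_cylinders; apply: sub_sigma_algebra; right;
    exists n, u. Qed.

Lemma measurable_shift : measurable_fun [set: seqborel d] (@Defs.shift d : seqborel
    d -> seqborel d).
Proof.
apply: (@measurability _ _ (seqborel d) (seqborel d) setT (@Defs.shift d) _
    seqborel_cylinders).
move=> _ [_ [->|[n [u ->]]] <-]; rewrite setTI; first by rewrite preimage_set0.
have -> : @Defs.shift d @^-1` cyl n u =
    \bigcup_(a : 'I_d.+1) cyl n.+1 (fun i => if i is j.+1 then u j else a).
  apply/seteqP; split=> w; last by move=> [a _ h] i hi; exact: (h i.+1).
  by move=> h; exists (w 0%N) => // -[|i] //; exact: h.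
by apply: countable_bigcupT_measurable => // a; exact: measurable_cyl.
Qed.

Lemma measurable_iter_shift n :
  measurable_fun [set: seqborel d] (iter n (@Defs.shift d) : seqborel d -> seqborel
      d).
Proof.
elim: n => [|n IH]; first exact: measurable_id.
exact: (measurableT_comp measurable_shift IH).
Qed.

Lemma measurable_preimage_shift n (E : set (seqborel d)) : measurable E ->
  measurable (iter n (@Defs.shift d) @^-1` E : set (seqborel d)).
Proof. by move=> mE; rewrite -[_ @^-1` _]setTI; exact: measurable_iter_shift. Qed.

Lemma iter_shiftE n w i : iter n (@Defs.shift d) w i = w (n + i)%N.
Proof. by elim: n i => // n IH i; rewrite iterS /Defs.shift IH addSnnS. Qed.

End Cylinders.

(** * Independence and mixing for the Bernoulli measure *)

Section BernoulliShift.
Variables (R : realType) (d : nat) (nu : probability (seqborel d) R).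
Hypothesis bern : is_bernoulli nu.
Notation S := (@Defs.shift d).
Notation seqb := (set (seqborel d)).

Lemma cyl_setI_shift m n (u v : seqspace d) :
  cyl m u `&` iter m S @^-1` cyl n v =
  cyl (m + n) (fun i => if (i < m)%N then u i else v (i - m)%N).
Proof.
apply/seteqP; split=> [w [h1 h2] i hi|w h].
  case: ifPn => him; first exact: h1.
  rewrite -leqNgt in him; rewrite -(h2 (i - m)%N) ?iter_shiftE ?subnKC //.
  by rewrite ltn_subLR.
split=> i hi; first by rewrite h ?hi //; exact: ltn_addr.
by rewrite iter_shiftE h ?ltn_add2l // ltnNge leq_addr /= addKn.
Qed.

(** Both sides are finite measures in [E]. They agree on cylinders by concatenation of words, and
    these form a generating class stable under intersection. *)
Lemma bernoulli_cyl_shift m (u : seqspace d) (E : seqb) : measurable E ->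
  nu (cyl m u `&` iter m S @^-1` E) = ((d.+1%:R ^- m)%:E * nu E)%E.
Proof.
move=> mE.
have c0 : 0 <= d.+1%:R ^- m :> R by rewrite invr_ge0 exprn_ge0.
pose m1 : {measure set (seqborel d) -> \bar R} := image_measure (mrestr nu
    (measurable_cyl m u)) (measurable_iter_shift m).
pose m2 : {measure set (seqborel d) -> \bar R} := mscale (NngNum c0) nu.
suff : m1 E = m2 E by rewrite /m1 /m2 /= /image_measure /pushforward /mscale
    /mrestr /= setIC.
refine (@measure_unique _ R (seqborel d) (@cylinders d) (fun=> setT) _ _ _ _ m1 m2
    _ _ E mE).
- exact: seqborel_cylinders.
- exact: cylinders_setI.
- by move=> _; right; exists 0%N, (fun=> ord0); rewrite cyl0.
- by apply: bigcup_const; exists 0%N.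
- move=> _ [->|[n [v ->]]]; first by rewrite !measure0.
  rewrite /m1 /m2 /= /image_measure /pushforward /mscale /mrestr /= setIC
      cyl_setI_shift.
  by rewrite !bern -EFinM -invfM -exprD.
- move=> _; rewrite /m1 /= /image_measure /pushforward /mrestr /= preimage_setT setTI.
  by apply: le_lt_trans (probability_le1 _ (measurable_cyl m u)) _; rewrite ltry.
Qed.

Lemma bernoulli_shift (E : seqb) : measurable E -> nu (S @^-1` E) = nu E.
Proof.
move=> mE; have mSE := measurable_preimage_shift 1 mE.
pose F a : seqb := cyl 1 (fun=> a) `&` iter 1 S @^-1` E.
have -> : S @^-1` E = \big[setU/set0]_(a < d.+1) F a.
  rewrite -bigcup_seq; apply/seteqP; split=> [w Ew|w [a _ [_ h]]]; last exact: h.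
  exists (w 0%N) => /=; first by rewrite mem_index_enum.
  by split=> // -[].
rewrite measure_bigsetU_ord //; first last.
- apply/trivIsetP => a b _ _ ab; apply/seteqP;
    split=> // w [[/(_ 0%N isT) ha _] [/(_ 0%N isT) hb _]].
  by move/eqP: ab; apply; rewrite -ha -hb.
- by move=> a; apply: measurableI mSE; exact: measurable_cyl.
rewrite (eq_bigr (fun=> ((d.+1%:R^-1)%:E * nu E)%E)); last first.
  by move=> a _; rewrite -[d.+1%:R]expr1; exact: bernoulli_cyl_shift.
rewrite -(fineK (fin_num_measure nu _ mE)) -EFinM sumEFin sumr_const card_ord.
by rewrite -mulrnAl -[_^-1 *+ _]mulr_natl mulfV ?mul1r // pnatr_eq0.
Qed.

Lemma bernoulli_iter_shift n (E : seqb) : measurable E -> nu (iter n S @^-1` E) =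
    nu E.
Proof.
move=> mE; elim: n => [|n IH]; first by rewrite preimage_id.
rewrite -[RHS]IH -[RHS]bernoulli_shift; last exact: measurable_preimage_shift.
by congr (nu _); apply/seteqP; split=> w; rewrite /= -iterSr.
Qed.

Lemma bernoulli_cyl_indep m n (u : seqspace d) (E : seqb) : measurable E -> (m <=
    n)%N ->
  nu (cyl m u `&` iter n S @^-1` E) = (nu (cyl m u) * nu E)%E.
Proof.
move=> mE mn; rewrite bern -(bernoulli_iter_shift (n - m) mE).
rewrite -(bernoulli_cyl_shift _ u); last exact: measurable_preimage_shift.
by congr (nu (_ `&` _)); apply/seteqP; split=> w; rewrite /= -iterD subnK.
Qed.

Let pr (E : seqb) : R := fine (nu E).

Let prE (E : seqb) : measurable E -> nu E = (pr E)%:E.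
Proof. by move=> mE; rewrite /pr fineK // fin_num_measure. Qed.

Let pr_ge0 (E : seqb) : 0 <= pr E. Proof. exact: fine_ge0. Qed.

Let prU (E F : seqb) : measurable E -> measurable F -> E `&` F = set0 ->
  pr (E `|` F) = pr E + pr F.
Proof.
move=> mE mF EF; rewrite /pr measureU //.
by rewrite fineD // fin_num_measure.
Qed.

Let le_pr (E F : seqb) : measurable E -> measurable F -> E `<=` F -> pr E <= pr F.
Proof.
move=> mE mF EF; rewrite -lee_fin -!prE //.
by apply: le_measure; rewrite ?inE.
Qed.

(** Only [F] has to be approximated: for a cylinder [F] the independence from the shifted [E] is
    exact once n reaches its length, whatever [E] is. The Dynkin class argument extends this to all
    [F]. *)
Lemma bernoulli_mixing (E F : seqb) : measurable E -> measurable F ->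
  pr (F `&` iter n S @^-1` E) @[n --> \oo] --> pr F * pr E.
Proof.
move=> mE; move: F; pose X n : seqb := iter n S @^-1` E.
have mX n : measurable (X n) by exact: measurable_preimage_shift.
have prX n : pr (X n) = pr E by rewrite /pr bernoulli_iter_shift.
pose P (F : seqb) := pr (F `&` X n) @[n --> \oo] --> pr F * pr E.
suff H : forall F, <<s cylinders (d := d) >> F -> P F.
  by move=> F mF; apply: H; rewrite -seqborel_cylinders.
have prT : pr setT = 1 by rewrite /pr probability_setT.
apply: (dynkin_induction (seqborel_cylinders d) (@cylinders_setI d)).
- rewrite /P prT mul1r; under eq_fun do rewrite setTI prX; exact: cvg_cst.
- move=> _ [->|[m [u ->]]].
    rewrite /P; under eq_fun do rewrite set0I.
    by rewrite /pr measure0 mul0r; exact: cvg_cst.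
  apply: (cvg_trans _ (@cvg_cst _ (pr (cyl m u) * pr E) _ \oo _)).
  apply: near_eq_cvg; exists m => // n /= mn.
  rewrite /pr bernoulli_cyl_indep // fineM // ?fin_num_measure //.
  exact: measurable_cyl.
- move=> F mF PF; rewrite /P.
  have C G : measurable G -> pr (~` F `&` G) = pr G - pr (F `&` G).
    move=> mG; apply/eqP; rewrite eq_sym subr_eq -prU.
    - by rewrite -setIUl setUC setUv setTI.
    - by apply: measurableI => //; exact: measurableC.
    - exact: measurableI.
    - by rewrite setIACA setICl set0I.
  have -> : pr (~` F) = 1 - pr F by rewrite -prT -[~` F]setIT C // setIT.
  rewrite mulrBl mul1r.
  under eq_fun do rewrite C // prX.
  by apply: cvgB; [exact: cvg_cst|].
- move=> F mF tF PF; rewrite /P.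
  pose A : seqb := \bigcup_k F k.
  pose AN N : seqb := \big[setU/set0]_(k < N.+1) F k.
  have mA : measurable A by exact: bigcupT_measurable.
  have mAN N : measurable (AN N) by exact: bigsetU_measurable.
  have AE : \bigcup_N AN N = A by exact: bigcup_bigsetU_bigcup.
  have AN_sub N : AN N `<=` A by rewrite -AE; exact: bigcup_sup.
  have PU B C : measurable B -> measurable C -> B `&` C = set0 -> P B -> P C -> P
      (B `|` C).
    move=> mB mC BC PB PC; rewrite /P prU // mulrDl.
    have -> : (fun n => pr ((B `|` C) `&` X n)) = (fun n => pr (B `&` X n) + pr (C
        `&` X n)).
      apply/funext => n; rewrite setIUl prU //; try exact: measurableI.
      by rewrite setIACA BC set0I.
    exact: cvgD.
  have PAN N : P (AN N).
    elim: N => [|N IH]; first by rewrite /AN big_ord_recl big_ord0 setU0.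
    rewrite /AN big_ord_recr /=; apply: PU (mAN N) (mF N.+1) _ IH (PF N.+1).
    apply/seteqP; split=> // w [+ FN]; rewrite /AN -bigcup_seq => -[k _ /= Fk].
    move/trivIsetP : tF => /(_ k N.+1 I I); rewrite neq_ltn ltn_ord => /(_ isT) h.
    by have : (F k `&` F N.+1) w by []; rewrite h.
  have prAN : pr (AN N) @[N --> \oo] --> pr A.
    have : (nu \o AN) N @[N --> \oo] --> nu (\bigcup_N AN N).
      apply: nondecreasing_cvg_mu => //; first by rewrite AE.
      by apply/nondecreasing_seqP => N; rewrite /AN [X in (_ <= X)%O]big_ord_recr;
          apply/subsetPset => w; left.
    by rewrite AE [X in _ --> X](prE mA) => /fine_cvg.
  (* The part of [A] outside [AN N] contributes at most its own measure, which is below e / 3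
     uniformly in n. *)
  apply/cvgrPdist_lt => e e0.
  have e3 : 0 < e / 3 by lra.
  have [N _ /(_ N (leqnn N)) /= hN] := (cvgrPdist_lt _ _).1 prAN _ e3.
  have near_n := (cvgrPdist_lt _ _).1 (PAN N) _ e3.
  near=> n; have hn : `|pr (AN N) * pr E - pr (AN N `&` X n)| < e / 3 by near: n;
      exact: near_n.
  have D G : measurable G -> pr (A `&` G) = pr (AN N `&` G) + pr ((A `\` AN N) `&` G).
    move=> mG; have mD : measurable (A `\` AN N) by exact: measurableD.
    rewrite -prU; [|exact: measurableI|exact: measurableI|].
      by rewrite -setIUl setDUK.
    by rewrite setIACA setDIK set0I.
  have D1 := D _ (mX n); have D2 := D setT measurableT; rewrite !setIT in D2.
  have le : pr ((A `\` AN N) `&` X n) <= pr (A `\` AN N).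
    apply: le_pr; last exact: subIsetl; last exact: measurableD.
    by apply: measurableI => //; exact: measurableD.
  have E1 : pr E <= 1 by rewrite -prT; exact: le_pr.
  have := pr_ge0 ((A `\` AN N) `&` X n); have := pr_ge0 (A `\` AN N);
      have := pr_ge0 E.
  rewrite D1 D2 in hN *; move: hn hN le E1.
  move: (pr (_ `\` _)) (pr (_ `&` X n)) (pr (_ `&` X n)) (pr (AN N)) (pr E) => a b
      c x y.
  rewrite !ltr_norml => hn hN le E1 h1 h2 h3; nra.
Unshelve. all: by end_near. Qed.

End BernoulliShift.

(** * Symbolic coding of the triangle map *)

Section Coding.
Variables (R : realType) (M : 'M[R]_3) (d : nat) (g : 'I_d.+1 -> 'M[R]_3).
Variable f : 'cV[R]_3 -> 'cV[R]_3.
Hypotheses (AM : ATM M) (hf : linear_triangle_map M f) (tg : tile_family M g).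
Hypothesis M_gt1 : 1 < `|\det M|.
Implicit Types (v p q : 'cV[R]_3) (w u : seqspace d).
Notation S := (@Defs.shift d).

(** The branch of [w 0] is applied last, so that the images of D for growing [n] are nested. *)
Fixpoint word_map n w v : 'cV[R]_3 :=
  if n is n'.+1 then phi M (g (w 0%N)) *m word_map n' (S w) v else v.

Lemma word_map_domD n w v : domD v -> domD (word_map n w v).
Proof.
elim: n w => //= n IH w dv; have [Gg _ cg _] := tg.
by apply: tile_sub => //; exact: IH.
Qed.

Lemma eq_word_map n w u : (forall i, (i < n)%N -> w i = u i) ->
  word_map n w =1 word_map n u.
Proof.
elim: n w u => //= n IH w u h v; rewrite h //; congr (_ *m _).
by apply: IH => i hi; exact: (h i.+1).
Qed.

Lemma word_mapD n m w v :
  word_map (n + m) w v = word_map n w (word_map m (iter n S w) v).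
Proof. by elim: n w => //= n IH w; rewrite IH -iterSr. Qed.

Lemma phi_dist i v p : planeA v -> planeA p ->
  dot (phi M (g i) *m v - phi M (g i) *m p) (phi M (g i) *m v - phi M (g i) *m p) =
  `|\det M|^-1 * dot (v - p) (v - p).
Proof.
move=> hv hp; have Gg := family_inG tg i.
have s0 : sum0 (v - p) by move: hv hp; rewrite /planeA /sum0 /= !mxE; lra.
have hphi : sum0 (phi M (g i) *m (v - p)) by apply: sum0_aff => //; exact: phi_aff.
rewrite -mulmxBr -(inG_isom Gg s0) -(mulmx_phi _ _ AM) (ATM_similar AM hphi).
by rewrite mulrA mulVf ?mul1r // gt_eqF // (lt_trans ltr01).
Qed.

(** The contraction ratio of the inverse branches. *)
Let rho : R := (Num.sqrt `|\det M|)^-1.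

Let rho_ge0 : 0 <= rho. Proof. by rewrite invr_ge0 sqrtr_ge0. Qed.

Let rho_lt1 : rho < 1.
Proof.
have M0 : 0 < Num.sqrt `|\det M| by rewrite sqrtr_gt0 (lt_trans ltr01).
by rewrite invf_lt1 // -sqrtr1 ltr_sqrt // (lt_trans ltr01).
Qed.

Let rho2 : rho ^+ 2 = `|\det M|^-1.
Proof. by rewrite exprVn sqr_sqrtr. Qed.

Lemma word_map_dist n w v p i : domD v -> domD p ->
  `|word_map n w v i 0 - word_map n w p i 0| <= 2 * rho ^+ n.
Proof.
move=> dv dp.
(* The constant 4 is a crude bound for the squared diameter of D. *)
have D : dot (word_map n w v - word_map n w p) (word_map n w v - word_map n w p) <=
    4 * (rho ^+ n) ^+ 2.
  elim: n w => [|n IH] w /=.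
    rewrite expr0 expr1n mulr1 dotE !mxE.
    by move: dv dp; rewrite /domD /planeA /= => -[? ?] [? ?]; nra.
  rewrite phi_dist; [|by case: (word_map_domD n (S w) dv)|by case: (word_map_domD n
      (S w) dp)].
  rewrite (exprS rho) exprMn rho2 mulrCA ler_pM2l //.
  by rewrite invr_gt0 (lt_trans ltr01).
have rn : 0 <= rho ^+ n by exact: exprn_ge0.
have : (word_map n w v i 0 - word_map n w p i 0) ^+ 2 <= (2 * rho ^+ n) ^+ 2.
  apply: (@le_trans _ _ (4 * (rho ^+ n) ^+ 2)); last by rewrite exprMn; lra.
  apply: le_trans D; rewrite dotE !mxE.
  move: (word_map n w v) (word_map n w p) => v' p'.
  by move: i; elim/forall_ord3; have := sqr_ge0 (v' 0 0 - p' 0 0);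
   have := sqr_ge0 (v' 1 0 - p' 1 0); have := sqr_ge0 (v' 2 0 - p' 2 0);
   rewrite !expr2; lra.
by move=> h; rewrite -(@ler_pXn2r _ 2) ?nnegrE ?mulr_ge0 // real_normK ?num_real.
Qed.

Definition limit_point w : 'cV[R]_3 :=
  \col_i limn (fun n => word_map n w (center R) i 0).

Let center_domD : domD (center R). Proof. exact/intD_domD/center_intD. Qed.

Let bound_cvg0 (K : R) : K * rho ^+ n @[n --> \oo] --> (0 : R).
Proof.
rewrite -(mulr0 K); apply: cvgMl_tmp; apply: cvg_expr.
by rewrite ger0_norm.
Qed.

Lemma word_map_cauchy n m w i : (n <= m)%N ->
  `|word_map n w (center R) i 0 - word_map m w (center R) i 0| <= 2 * rho ^+ n.
Proof.
move=> nm; rewrite -(subnKC nm) word_mapD; apply: word_map_dist => //.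
exact: word_map_domD.
Qed.

Lemma cvg_limit_point w i :
  word_map n w (center R) i 0 @[n --> \oo] --> limit_point w i 0.
Proof.
rewrite mxE; apply: cauchy_cvg; apply: cauchy_exP => e e0.
have := (cvgrPdist_lt _ _).1 (bound_cvg0 2) _ e0; move=> [N _ /(_ N (leqnn N))] /=.
rewrite sub0r normrN ger0_norm ?mulr_ge0 ?exprn_ge0 // => hN.
exists (word_map N w (center R) i 0); exists N => // m /= Nm.
by rewrite /ball /=; apply: le_lt_trans hN; exact: word_map_cauchy.
Qed.

Lemma limit_point_dist w i n v : domD v ->
  `|limit_point w i 0 - word_map n w v i 0| <= 4 * rho ^+ n.
Proof.
move=> dv; have h1 : `|limit_point w i 0 - word_map n w (center R) i 0| <= 2 * rho
    ^+ n.
  have c := @cvg_limit_point w i.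
  rewrite -(cvg_lim _ c) // ler_distl; apply/andP; split.
    apply: limr_ge; first by apply/cvg_ex; eexists; exact: c.
    by exists n => // m /= nm; have := word_map_cauchy w i nm; rewrite ler_norml; lra.
  apply: limr_le; first by apply/cvg_ex; eexists; exact: c.
  by exists n => // m /= nm; have := word_map_cauchy w i nm; rewrite ler_norml; lra.
have := word_map_dist n w i dv center_domD.
move: h1; rewrite !ler_norml; lra.
Qed.

Lemma limit_point_domD w : domD (limit_point w).
Proof.
apply: (@closed_cvg _ _ \oo _ (fun n => word_map n w (center R)) (@domD R)).
- exact: closed_domD.
- by apply: nearW => n; exact: word_map_domD.
- by apply: cvg_mx => i j; rewrite ord1; exact: cvg_limit_point.
Qed.

Lemma eq_bound (x y K : R) : (forall n, `|x - y| <= K * rho ^+ n) -> x = y.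
Proof.
move=> h; apply/eqP; rewrite -subr_eq0 -normr_le0.
rewrite -(cvg_lim (@norm_hausdorff _ _) (bound_cvg0 K)).
apply: limr_ge; last exact: nearW.
by apply/cvg_ex; eexists; exact: bound_cvg0.
Qed.

Lemma limit_point_unique w v :
  (forall n, exists2 p, domD p & v = word_map n w p) -> limit_point w = v.
Proof.
move=> h; apply/colP => i; apply: (@eq_bound _ _ 4) => n.
by have [p dp ->] := h n; exact: limit_point_dist.
Qed.

Lemma limit_point_phi w : limit_point w = phi M (g (w 0%N)) *m limit_point (S w).
Proof.
apply/colP => i.
have c1 : word_map n.+1 w (center R) i 0 @[n --> \oo] --> limit_point w i 0.
  by rewrite (cvg_shiftS (fun n => word_map n w (center R) i 0));
      exact: cvg_limit_point.
have c2 : word_map n.+1 w (center R) i 0 @[n --> \oo] -->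
    (phi M (g (w 0%N)) *m limit_point (S w)) i 0.
  rewrite mulmx_cV3 /=; under eq_fun do rewrite mulmx_cV3.
  by apply: cvgD; [apply: cvgD|]; apply: cvgMl_tmp; exact: cvg_limit_point.
exact: cvg_unique c1 c2.
Qed.

Lemma f_limit_point w : f (limit_point w) = limit_point (S w).
Proof. by rewrite limit_point_phi (f_phi AM hf tg) //; exact: limit_point_domD. Qed.

Lemma continuous_limit_point : continuous (limit_point : seqspace d -> 'cV[R]_3).
Proof.
move=> w; apply: (@cvg_mx _ _ (nbhs w) _) => i j; rewrite ord1.
apply/cvgrPdist_lt => e e0.
(* Sequences with the same first N symbols have limit points within 4 rho^N of one common point,
   hence the 8. *)
have := (cvgrPdist_lt _ _).1 (bound_cvg0 8) _ e0; move=> [N _ /(_ N (leqnn N))] /=.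
rewrite sub0r normrN ger0_norm ?mulr_ge0 ?exprn_ge0 // => hN.
have : nbhs w (cyl N w) by apply: open_nbhs_nbhs; split => //; exact: open_cyl.
apply: filterS => u hu /=; apply: le_lt_trans hN.
have := limit_point_dist w i N center_domD;
    have := limit_point_dist u i N center_domD.
rewrite (eq_word_map hu) !ler_norml; lra.
Qed.

End Coding.

(** * Itineraries and the uniform measure on D *)

Section Semiconjugacy.
Variables (R : realType) (M : 'M[R]_3) (d : nat) (g : 'I_d.+1 -> 'M[R]_3).
Variable f : 'cV[R]_3 -> 'cV[R]_3.
Hypotheses (AM : ATM M) (hf : linear_triangle_map M f) (tg : tile_family M g).
Hypothesis detM : `|\det M| = d.+1%:R.
Hypothesis M_gt1 : 1 < `|\det M|.
Implicit Types (v p q : 'cV[R]_3) (w u : seqspace d) (E : set 'cV[R]_3).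
Notation leb := (@lebesgue_measure R).
Notation plane := (measurableTypeR R * measurableTypeR R)%type.
Notation leb2 := (leb \x leb)%E.
Notation S := (@Defs.shift d).
Notation brl := (@borelT R).

(** This set takes finitely many values, each on a Borel set. As [index_of] depends on it alone, the
    choice among overlapping pieces is measurable; the default [ord0] occurs only off D. *)
Definition containing v : {set 'I_d.+1} := [set i | `[< piece M g i v >]]%SET.

Definition index_of v : 'I_d.+1 := odflt ord0 [pick i in containing v].

Lemma index_ofP v : domD v -> piece M g (index_of v) v.
Proof.
rewrite -(piece_cover AM hf tg) => -[i _ pi]; rewrite /index_of.
case: pickP => [j|/(_ i)]; first by rewrite inE => /asboolP.
by rewrite inE => /asboolP.
Qed.

Lemma borel_piece i : borel (piece M g i).
Proof. by apply: borel_closed; apply: closed_piece tg _. Qed.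

Lemma measurable_index (P : pred 'I_d.+1) : measurable ([set v | P (index_of v)] :
    set brl).
Proof.
have mc (B : {set 'I_d.+1}) : measurable ([set v | containing v = B] : set brl).
  have -> : [set v | containing v = B] = \bigcap_(i in [set: 'I_d.+1])
      (if i \in B then piece M g i else ~` piece M g i).
    apply/seteqP; split=> [v <- i _|v h]; first by rewrite inE; case: asboolP.
    apply/setP => i; rewrite inE; have := h i I.
    by case: ifP => iB; [move/asboolP|move/asboolPn/negbTE].
  apply: fin_bigcap_measurable => // i _; case: ifP => _; first exact: borel_piece.
  by apply: measurableC; exact: borel_piece.
have -> : [set v | P (index_of v)] = \bigcup_(B in [set B : {set 'I_d.+1} |
    P (odflt ord0 [pick i in B])]) [set v | containing v = B].
  apply/seteqP; split=> [v Pv|v [B /= PB hB]]; first by exists (containing v).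
  by rewrite /index_of hB.
by apply: fin_bigcup_measurable.
Qed.

(** A Borel substitute for [f], which is arbitrary off D. *)
Definition step v : 'cV[R]_3 := invmx (g (index_of v)) *m (M *m v).

Lemma stepE v : domD v -> step v = f v.
Proof. by move=> dv; rewrite (f_piece AM hf tg (index_ofP dv)). Qed.

Lemma step_domD v : domD v -> domD (step v).
Proof. by move=> dv; rewrite stepE //; case: (hf dv). Qed.

Lemma iter_step v n : domD v -> domD (iter n step v) /\ iter n step v = iter n f v.
Proof.
move=> dv; elim: n => // n [IH1 IH2]; rewrite !iterS; split; first exact: step_domD.
by rewrite stepE // IH2.
Qed.

Lemma borel_branch i E : borel E -> borel [set v | E (invmx (g i) *m (M *m v))].
Proof.
move=> bE; have := borel_mulmx (invmx (g i) *m M) bE.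
by congr borel; apply/seteqP; split=> v; rewrite /= mulmxA.
Qed.

Lemma measurable_step : measurable_fun [set: brl] (step : brl -> brl).
Proof.
move=> _ E bE; rewrite setTI.
have -> : step @^-1` E = \bigcup_(i in [set: 'I_d.+1])
   ([set v | index_of v == i] `&` [set v | E (invmx (g i) *m (M *m v))]).
  apply/seteqP; split=> [v Ev|v [i _ [/= /eqP <-]//]].
  by exists (index_of v) => //; split => /=.
apply: fin_bigcup_measurable => // i _; apply: measurableI.
  exact: (measurable_index (pred1 i)).
exact: borel_branch.
Qed.

Lemma measurable_iter_step n : measurable_fun [set: brl] (iter n step : brl -> brl).
Proof.
elim: n => [|n IH]; first exact: measurable_id.
exact: (measurableT_comp measurable_step IH).
Qed.

Definition code v : seqspace d := fun n => index_of (iter n step v).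

Lemma code_step v : code (step v) = S (code v).
Proof. by apply/funext => n; rewrite /code /Defs.shift iterSr. Qed.

Lemma word_map_code n v : domD v -> v = word_map M g n (code v) (iter n step v).
Proof.
elim: n v => //= n IH v dv.
rewrite -iterS iterSr -code_step -IH; last exact: step_domD.
by rewrite (phiK AM tg).
Qed.

Lemma limit_point_code v : domD v -> limit_point M g (code v) = v.
Proof.
move=> dv; apply: (limit_point_unique AM tg M_gt1) => n.
by exists (iter n step v); [case: (iter_step n dv)|exact: word_map_code].
Qed.

Lemma range_limit_point : range (limit_point M g) = @domD R.
Proof.
apply/seteqP; split=> [_ [w _ <-]|v dv]; first exact: limit_point_domD.
by exists (code v) => //; exact: limit_point_code.
Qed.

Lemma preimage_code_cyl n u :
  code @^-1` cyl n.+1 u = [set v | index_of v == u 0%N] `&` step @^-1` (code @^-1`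
      cyl n (S u)).
Proof.
apply/seteqP; split=> [v h|v [/= /eqP h0 h] [|i] hi //].
  split; first by apply/eqP; exact: (h 0%N).
  by move=> i hi; rewrite code_step; exact: (h i.+1).
by have := h i hi; rewrite code_step.
Qed.

Lemma measurable_code : measurable_fun [set: brl] (code : brl -> seqborel d).
Proof.
apply: (@measurability _ _ brl (seqborel d) setT code _ (seqborel_cylinders d)).
move=> _ [_ [->|[n [u ->]]] <-]; rewrite setTI; first by rewrite preimage_set0.
elim: n u => [|n IH] u; first by rewrite cyl0 preimage_setT.
rewrite preimage_code_cyl; apply: measurableI.
  exact: (measurable_index (pred1 (u 0%N))).
by rewrite -[_ @^-1` _]setTI; apply: measurable_step.
Qed.

Let aD : R := fine (area2 (@domD R)).

Let aD_gt0 : 0 < aD.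
Proof. by rewrite fine_gt0 // area2_domD_gt0 area2_domD_lty. Qed.

Let aDV_ge0 : 0 <= aD^-1. Proof. by rewrite invr_ge0 ltW. Qed.

Definition uniform_domD : {measure set brl -> \bar R} :=
  mscale (NngNum aDV_ge0) (mrestr (image_measure leb2 (@measurable_chart R))
      (@borel_domD R)).

Lemma uniform_domDE E : uniform_domD E = (aD^-1%:E * area2 (E `&` @domD R))%E.
Proof. by []. Qed.

Lemma eq_uniform_domD E F : (forall v, domD v -> E v <-> F v) ->
  uniform_domD E = uniform_domD F.
Proof.
move=> h; rewrite !uniform_domDE; congr (_ * area2 _)%E.
by apply/seteqP; split=> v [Ev dv]; split=> //; apply/h.
Qed.

Lemma uniform_domD_setT : uniform_domD setT = 1%E.
Proof.
by rewrite uniform_domDE setTI -(fineK (@area2_domD_fin R)) -EFinM mulVf ?gt_eqF.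
Qed.

Lemma area2_le E F : borel E -> borel F -> E `<=` F -> (area2 E <= area2 F)%E.
Proof.
move=> bE bF EF; apply: le_measure; rewrite ?inE; try exact: borel_measurable_chart.
by move=> z; exact: EF.
Qed.

Lemma muD_uniform E : borel E -> (muD E)%:E = uniform_domD E.
Proof.
move=> bE.
have finE : area2 (E `&` @domD R) \is a fin_num.
  rewrite ge0_fin_numE //; apply: le_lt_trans (@area2_domD_lty R).
  by apply: area2_le; [apply: borelI => //; exact: borel_domD|exact: borel_domD|].
rewrite uniform_domDE /muD /area -[((_ \x _) (_ @^-1` (_ `&` _)))%E]/(area2 (E `&`
    @domD R)).
rewrite -[((_ \x _) (_ @^-1` _))%E]/(area2 (@domD R)) !fineM ?area2_domD_fin //.
rewrite -{2}(fineK finE) -EFinM; congr EFin.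
have s3 : Num.sqrt 3 != 0 :> R by rewrite gt_eqF // sqrtr_gt0.
by rewrite /= invfM mulrACA mulfV // mul1r mulrC.
Qed.

Lemma area2_diff0 E F Z : borel E -> borel F -> F `<=` E -> borel Z ->
  E `\` F `<=` Z -> area2 Z = 0%E -> area2 E = area2 F.
Proof.
move=> bE bF FE bZ EFZ Z0.
have mE := borel_measurable_chart bE; have mF := borel_measurable_chart bF.
have bD : borel (E `\` F) by apply: (@measurableD _ brl).
have D0 : area2 (E `\` F) = 0%E.
  by apply/eqP; rewrite -measure_le0 -[X in (_ <= X)%E]Z0; exact: area2_le.
have -> : area2 E = leb2 (@chart R @^-1` F `|` @chart R @^-1` (E `\` F)).
  by congr (leb2 _); rewrite -preimage_setU setDUK.
by rewrite measureU0 //; exact: borel_measurable_chart.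
Qed.

Lemma borel_boundary : borel (@domD R `\` @intD R).
Proof. by apply: (@measurableD _ brl); [exact: borel_domD|exact: borel_intD]. Qed.

(* Up to null sets, the points of the piece of index i that [step] sends to E
   are the image of E by the contraction [phi M (g i)].                      *)
Lemma uniform_domD_step i E : borel E ->
  uniform_domD ([set v | index_of v == i] `&` step @^-1` E) =
  ((d.+1%:R^-1)%:E * uniform_domD E)%E.
Proof.
move=> bE; have Gg := family_inG tg i; have [_ ginj _ _] := tg.
set X := _ `&` _.
pose N := invmx (g i) *m M.
have hN : affmx N.
  by apply: affmxM; [apply: affmx_inv;
      [exact: inG_unit|exact: inG_aff]|exact: ATM_aff].
have uN : N \in unitmx by rewrite unitmx_mul unitmx_inv inG_unit // ATM_unit.
have dN : `|\det N| = d.+1%:R.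
  by rewrite det_mulmx det_inv normrM normfV inG_det // invr1 mul1r.
have bI := @borel_intD R; have bD := @borel_domD R.
have bX : borel (X `&` @domD R).
  apply: borelI => //; apply: (@measurableI _ brl).
    exact: (measurable_index (pred1 i)).
  by rewrite -[_ @^-1` _]setTI; apply: measurable_step.
(* A point sent into the open triangle lies in no other piece, so the choice made by [index_of] is
   forced there. What is lost is the preimage of the boundary, a null set. *)
pose Y := [set v | (E `&` @intD R) (N *m v)].
have bY : borel Y by apply: borel_mulmx; exact: borelI.
have areaY : area2 Y = ((d.+1%:R^-1)%:E * area2 (E `&` @domD R))%E.
  rewrite (area2_preimage hN uN (borelI bE bI)) dN.
  congr (_ * _)%E; apply/esym.
  apply: (area2_diff0 _ _ _ borel_boundary) (area2_domD_intD R); try exact: borelI.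
    by move=> v [Ev /intD_domD].
  by move=> v [[Ev dv] ni]; split=> // iv; apply: ni.
rewrite !uniform_domDE muleCA -areaY; congr (_ * _)%E.
apply: (@area2_diff0 _ _ [set v | (@domD R `\` @intD R) (N *m v)]) => //.
- move=> v [Ev iv].
  have Nv : invmx (g i) *m (M *m v) = N *m v by rewrite mulmxA.
  have pv : piece M g i v by apply/(pieceP tg); rewrite Nv; exact: intD_domD.
  have dv : domD v by exact: piece_domD pv.
  have iE : index_of v = i.
    have /(pieceP tg) dj := index_ofP dv.
    apply/esym/ginj; apply: (tile_key Gg (family_inG tg _) iv dj).
    by rewrite -Nv !mulKVmx //; apply: inG_unit => //; exact: family_inG tg _.
  by split=> //; split; [rewrite /= iE|rewrite /= /step iE Nv].
- by apply: borel_mulmx; exact: borel_boundary.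
- move=> v [[[/= /eqP iE Ev] dv] nY].
  have Nv : invmx (g i) *m (M *m v) = N *m v by rewrite mulmxA.
  move: Ev; rewrite /step iE Nv => Ev.
  split; last by move=> iv; apply: nY.
  by rewrite -Nv; apply/(pieceP tg); rewrite -iE; exact: index_ofP.
- by rewrite (area2_preimage hN uN borel_boundary) area2_domD_intD mule0.
Qed.

Definition bernoulli_domD : set (seqborel d) -> \bar R :=
  image_measure uniform_domD measurable_code.

HB.instance Definition _ := Measure.on bernoulli_domD.

Let bernoulli_domD_setT : bernoulli_domD setT = 1%E.
Proof.
by rewrite /bernoulli_domD /image_measure /pushforward preimage_setT
    uniform_domD_setT.
Qed.

HB.instance Definition _ :=
  Measure_isProbability.Build _ _ _ bernoulli_domD bernoulli_domD_setT.

Lemma bernoulli_domD_cyl n u : bernoulli_domD (cyl n u) = (d.+1%:R ^- n)%:E.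
Proof.
elim: n u => [|n IH] u; first by rewrite cyl0 bernoulli_domD_setT expr0 invr1.
rewrite /bernoulli_domD /image_measure /pushforward preimage_code_cyl.
rewrite uniform_domD_step; last first.
  by rewrite -[_ @^-1` _]setTI; apply: measurable_code => //; exact: measurable_cyl.
by rewrite [X in (_ * X)%E]IH -EFinM -invfM -exprS.
Qed.

(** Coding followed by [limit_point] is the identity on D, so the uniform measure is recovered. *)
Lemma bernoulli_domD_limit_point E : borel E ->
  bernoulli_domD (limit_point M g @^-1` E) = (muD E)%:E.
Proof.
move=> bE; rewrite (muD_uniform bE) /bernoulli_domD /image_measure /pushforward.
by apply: eq_uniform_domD => v dv /=; rewrite limit_point_code.
Qed.

Lemma semiconjugacy : semiconjugate_bernoulli d f.
Proof.
exists bernoulli_domD, (limit_point M g); split.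
- by move=> n u; exact: bernoulli_domD_cyl.
- exact: continuous_limit_point.
- exact: range_limit_point.
- by move=> w; rewrite (f_limit_point AM hf tg M_gt1).
- exact: bernoulli_domD_limit_point.
Qed.

Lemma borel_iter_preimage n E : borel E -> borel (@domD R `&` iter n f @^-1` E).
Proof.
move=> bE.
have -> : @domD R `&` iter n f @^-1` E = @domD R `&` iter n step @^-1` E.
  by apply/seteqP; split=> v [dv Ev]; split=> //; have [_ h] := iter_step n dv;
      rewrite /= ?h // -h.
apply: borelI; first exact: borel_domD.
by rewrite -[_ @^-1` _]setTI; apply: measurable_iter_step.
Qed.

End Semiconjugacy.

(** * Transfer of mixing from the shift, and ergodicity *)

Section Mixing.
Variables (R : realType) (f : 'cV[R]_3 -> 'cV[R]_3).
Implicit Types E F : set 'cV[R]_3.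

Lemma muD_domD E : muD (@domD R `&` E) = muD E.
Proof. by rewrite /muD setIAC setIid setIC. Qed.

(** The semiconjugacy speaks directly only of measurability in the sequence space; the second
    hypothesis supplies it in D. *)
Lemma semiconjugate_mixing d : semiconjugate_bernoulli d f ->
  (forall n E, borel E -> borel (@domD R `&` iter n f @^-1` E)) -> mixing f.
Proof.
move=> [nu [h [bern ch hD hS nuh]]] bf.
have mh E : borel E -> measurable (h @^-1` E : set (seqborel d)).
  move=> bE; suff m : measurable_fun [set: seqborel d] (h : _ -> @borelT R).
    by rewrite -[_ @^-1` _]setTI; exact: m.
  apply: (@measurability _ _ (seqborel d) (@borelT R) setT h (@open 'cV[R]_3) erefl).
  move=> _ [U oU <-]; rewrite setTI; apply: sub_sigma_algebra.
  by apply: open_comp oU => w _; exact: ch.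
have iS n w : h (iter n (@Defs.shift d) w) = iter n f (h w).
  by elim: n => // n IH; rewrite !iterS hS IH.
have Dh w : domD (h w) by rewrite -hD; exists w.
have nuE E : borel E -> muD E = fine (nu (h @^-1` E)) by move=> /nuh ->.
have nu_iter n E F : borel E -> borel F -> muD (F `&` iter n f @^-1` E) =
    fine (nu (h @^-1` F `&` iter n (@Defs.shift d) @^-1` (h @^-1` E))).
  move=> bE bF; rewrite -muD_domD setICA nuE; last by apply: borelI => //; exact: bf.
  congr (fine (nu _)); apply/seteqP; split=> w /=; rewrite iS.
    by move=> [? []].
  by move=> [].
split.
  move=> E bE; split; first exact: (bf 1%N).
  have bT : borel [set: 'cV[R]_3] by apply: borel_open; exact: openT.
  rewrite -[f @^-1` E]setTI (nu_iter 1%N) // preimage_setT setTI nuE //.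
  by congr fine; apply: (bernoulli_shift bern); exact: mh.
move=> E F bE bF; rewrite (nuE E) // (nuE F) //.
under eq_fun do rewrite nu_iter //.
by apply: (bernoulli_mixing bern); exact: mh.
Qed.

(** Mixing of an invariant set with itself makes its measure equal to its square. *)
Lemma mixing_ergodic : mixing f -> ergodic f.
Proof.
move=> [mp mix]; split=> // E bE ED fE.
have inv n : E `&` iter n f @^-1` E = E.
  apply/seteqP; split=> [v []//|v Ev]; split=> //=.
  elim: n => // n IH; rewrite iterS.
  by have [] : (@domD R `&` f @^-1` E) (iter n f v) by rewrite fE.
have : muD E @[n --> \oo] --> muD E * muD E.
  by have := mix E E bE bE; under eq_fun do rewrite inv.
move/(cvg_unique (@norm_hausdorff _ _) (cvg_cst (muD E))) => e.
have : muD E * (muD E - 1) = 0 by rewrite mulrBr mulr1 -e subrr.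
by move/eqP; rewrite mulf_eq0 subr_eq0 => /orP[] /eqP; [left|right].
Qed.

End Mixing.

Theorem corollary2 (R : realType) (M : 'M[R]_3) (f : 'cV[R]_3 -> 'cV[R]_3)
    (hM : ATM M) (hf : linear_triangle_map M f) :
  (exists a b c : 'cV[R]_3,
     [/\ mulmx M @` @domD R = triangle a b c,
         triangle a b c `<=` @planeA R,
         triangle_30_60_90 a b c &
         [/\ segm a b `<=` @mirrors R,
             segm b c `<=` @mirrors R &
             segm c a `<=` @mirrors R]]) /\
  (exists (d : nat) (g : 'I_d.+1 -> 'M[R]_3),
     [/\ `|\det M| = d.+1%:R,
         forall i, inG (g i),
         tiles (fun i => mulmx (g i) @` @domD R) (mulmx M @` @domD R),
         markov_partition f
           (fun i => mulmx M @^-1` (mulmx (g i) @` @domD R)) &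
         1 < `|\det M| -> semiconjugate_bernoulli d f]) /\
  (1 < `|\det M| -> mixing f /\ ergodic f).
Proof.
split.
  have [pA pB pC] : [/\ planeA (vA R), planeA (vB R) & planeA (vC R)].
    by split; [case: (vA_domD R)|case: (vB_domD R)|case: (vC_domD R)].
  have img : mulmx M @` @domD R = triangle (M *m vA R) (M *m vB R) (M *m vC R).
    by rewrite domD_triangle image_triangle.
  exists (M *m vA R), (M *m vB R), (M *m vC R); split=> //.
  - rewrite -img => _ [v [hv _] <-]; exact: planeA_affmx (ATM_aff hM) hv.
  - exact: ATM_triangle_30_60_90.
  - split; [apply: (segm_wall (k := 1))|apply: (segm_wall (k := 0))|apply:
      (segm_wall (k := 2))];
      by rewrite // /wall /= ?vec3E ?subrr.
have [n [g tg]] := tile_family_exists hM.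
have := card_tiles hM hf tg.
case: n g tg => [|d] g tg detM.
  (* An empty family would give det M = 0. *)
  by have := ATM_unit hM; rewrite unitmxE unitfE -normr_eq0 -detM eqxx.
have sc : 1 < `|\det M| -> semiconjugate_bernoulli d f.
  by move=> M1; exact: (semiconjugacy hM hf tg (esym detM) M1).
split; first exists d, g; first split=> //.
- exact: family_inG tg.
- exact: chambers_tile hM hf tg.
- exact: pieces_markov hM hf tg.
move=> M1; suff mx : mixing f by split=> //; exact: mixing_ergodic.
by apply: semiconjugate_mixing (sc M1) _ => k E;
    exact: borel_iter_preimage hM hf tg _ _.
Qed.
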